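(* Let $\Sigma$ and $\Omega$ be finite sets. The set of hypotheses $\mathcal{H}_{\mathrm{kapt}}$ over the alphabet $\Sigma+T_{\mathrm{DL}}$ reduces to the empty set; moreover $\mathsf{KA}_{\mathcal{H}_{\mathrm{kapt}}}$ is complete and the relation $\{(e,f)\mid\mathsf{KA}_{\mathcal{H}_{\mathrm{kapt}}}\vdash e=f\}$ is decidable.
   Context: Regular expressions $T(X)$ over an alphabet $X$: $e,f::=e+f\mid e\cdot f\mid e^*\mid 0\mid 1\mid a$ ($a\in X$), with usual language $\llbracket e\rrbracket$. Kleene algebra axioms: idempotent semiring axioms plus $1+xx^*\le x^*$, $x+yz\le z\Rightarrow y^*x\le z$, $x+yz\le y\Rightarrow xz^*\le y$. A hypothesis is a pair $e\le f$; an equation as hypothesis stands for two inequations. $\mathsf{KA}_H\vdash e=f$ means derivable in equational logic from all instances of the Kleene algebra axioms and the hypotheses in $H$, letters being constants (no substitution rule); $\mathsf{KA}_H\vdash H'$ means all inequations of $H'$ are derivable. The $H$-closure $H^\star(L)$ is the smallest language containing $L$ such that for all $e\le f\in H$ and words $u,v$, $u\llbracket f\rrbracket v\subseteq H^\star(L)$ implies $u\llbracket e\rrbracket v\subseteq H^\star(L)$. $\mathsf{KA}_H$ is complete if $H^\star(\llbracket e\rrbracket)=H^\star(\llbracket f\rrbracket)$ implies $\mathsf{KA}_H\vdash e=f$. For $\Gamma\subseteq\Sigma'$, $H$ over $\Sigma'$, $H'$ over $\Gamma$: $H$ reduces to $H'$ if $\mathsf{KA}_H\vdash H'$ and there is $r:T(\Sigma')\to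 T(\Gamma)$ with $\mathsf{KA}_H\vdash e=r(e)$ and $H^\star(\llbracket e\rrbracket)\cap\Gamma^*\subseteq H'^\star(\llbracket r(e)\rrbracket)$ for all $e$; ''reduces to the empty set'' means $H'=\emptyset$ for some such $\Gamma$. $T_{\mathrm{DL}}$ is the set of lattice expressions $\phi::=\phi\vee\phi\mid\phi\wedge\phi\mid o$ ($o\in\Omega$), each a single letter of $\Sigma+T_{\mathrm{DL}}$. $\mathcal{H}_{\mathrm{dl}}$ is the set of all instances (equations between elements of $T_{\mathrm{DL}}$) of the distributive lattice axioms, and $\mathcal{H}_{\mathrm{kapt}}=\mathcal{H}_{\mathrm{dl}}\cup\{\phi\wedge\psi=\phi\cdot\psi,\ \phi\vee\psi=\phi+\psi\mid\phi,\psi\in T_{\mathrm{DL}}\}\cup\{\phi\le 1\mid\phi\in T_{\mathrm{DL}}\}$. Atoms (nonempty subsets of $\Omega$, read as conjunctions of their elements) are regarded as elements of $T_{\mathrm{DL}}$. *)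

(* Defs.v *)
From Stdlib Require Import Relation_Operators.
From mathcomp Require Import all_boot.

Set Implicit Arguments.
Unset Strict Implicit.
Unset Printing Implicit Defensive.

(** * Regular expressions and languages *)

Inductive regex (X : Type) : Type :=
| Plus of regex X & regex X
| Dot of regex X & regex X
| Star of regex X
| Zero
| One
| Letter of X.

Arguments Zero {X}.
Arguments One {X}.

Declare Scope regex_scope.
Delimit Scope regex_scope with rx.
Bind Scope regex_scope with regex.
Notation "e + f" := (Plus e f) : regex_scope.
Notation "e * f" := (Dot e f) : regex_scope.
Notation "0" := Zero : regex_scope.
Notation "1" := One : regex_scope.

Fixpoint map_regex (X Y : Type) (g : X -> Y) (e : regex X) : regex Y :=
  match e with
  | Plus e f => Plus (map_regex g e) (map_regex g f)
  | Dot e f => Dot (map_regex g e) (map_regex g f)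
  | Star e => Star (map_regex g e)
  | Zero => Zero
  | One => One
  | Letter a => Letter (g a)
  end.

Definition language (X : Type) := seq X -> Prop.

Inductive star_lang (X : Type) (L : language X) : language X :=
| star_nil : star_lang L [::]
| star_app u v : L u -> star_lang L v -> star_lang L (u ++ v).

Fixpoint lang (X : Type) (e : regex X) : language X :=
  match e with
  | Plus e f => fun w => lang e w \/ lang f w
  | Dot e f => fun w => exists u v, [/\ w = u ++ v, lang e u & lang f v]
  | Star e => star_lang (lang e)
  | Zero => fun _ => False
  | One => fun w => w = [::]
  | Letter a => fun w => w = [:: a]
  end.

(** * Kleene algebra with hypotheses *)

(** [H e f] means that the inequation [e <= f] belongs to [H]. *)
Definition hyps (X : Type) := regex X -> regex X -> Prop.

Definition no_hyps (X : Type) : hyps X := fun _ _ => False.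

Definition hypsU (X : Type) (H K : hyps X) : hyps X :=
  fun e f => H e f \/ K e f.

(** An equation, used as a hypothesis, stands for two inequations. *)
Definition of_equations (X : Type) (E : regex X -> regex X -> Prop) : hyps X :=
  fun e f => E e f \/ E f e.

(** [ka H e f] is [KA_H |- e = f]; an inequation [e <= f] is [e + f = f]. *)
Inductive ka (X : Type) (H : hyps X) : regex X -> regex X -> Prop :=
| ka_refl e : ka H e e
| ka_sym e f : ka H e f -> ka H f e
| ka_trans e f g : ka H e f -> ka H f g -> ka H e g
| ka_plus e e' f f' : ka H e e' -> ka H f f' -> ka H (e + f) (e' + f')
| ka_dot e e' f f' : ka H e e' -> ka H f f' -> ka H (e * f) (e' * f')
| ka_star e e' : ka H e e' -> ka H (Star e) (Star e')
| ka_plusA e f g : ka H (e + (f + g)) ((e + f) + g)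
| ka_plusC e f : ka H (e + f) (f + e)
| ka_plus0 e : ka H (e + 0) e
| ka_plusI e : ka H (e + e) e
| ka_dotA e f g : ka H (e * (f * g)) ((e * f) * g)
| ka_dot1l e : ka H (1 * e) e
| ka_dot1r e : ka H (e * 1) e
| ka_dot0l e : ka H (0 * e) 0
| ka_dot0r e : ka H (e * 0) 0
| ka_dotDl e f g : ka H ((e + f) * g) (e * g + f * g)
| ka_dotDr e f g : ka H (e * (f + g)) (e * f + e * g)
| ka_star_unfold e : ka H ((1 + e * Star e) + Star e) (Star e)
| ka_star_indl x y z :
    ka H ((x + y * z) + z) z -> ka H (Star y * x + z) z
| ka_star_indr x y z :
    ka H ((x + y * z) + y) y -> ka H (x * Star z + y) y
| ka_hyp e f : H e f -> ka H (e + f) f.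

(** The least language containing [L] such that, for all [e <= f] in [H],
    [u [f] v] included in it implies [u [e] v] included in it. *)
Inductive hclosure (X : Type) (H : hyps X) (L : language X) : language X :=
| hclosure_incl w : L w -> hclosure H L w
| hclosure_step e f u v :
    H e f ->
    (forall w, lang f w -> hclosure H L (u ++ w ++ v)) ->
    forall w, lang e w -> hclosure H L (u ++ w ++ v).

Definition ka_complete (X : Type) (H : hyps X) : Prop :=
  forall e f : regex X,
    (forall w, hclosure H (lang e) w <-> hclosure H (lang f) w) -> ka H e f.

(** [H] over [X] reduces to [H'] over the sub-alphabet [Gam]; the inclusions of
    [T(Gam)] in [T(X)] and of words over [Gam] in words over [X] are
    [map_regex] and [map] of the coercion from the subtype. *)
Definition reduces (X : Type) (H : hyps X) (Gam : X -> Prop)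
    (H' : hyps (sig Gam)) : Prop :=
  let inj := map_regex (@proj1_sig X Gam) in
  (forall e f, H' e f -> ka H (inj e + inj f) (inj f)) /\
  exists r : regex X -> regex (sig Gam),
    forall e : regex X,
      ka H e (inj (r e)) /\
      forall w : seq (sig Gam),
        hclosure H (lang e) (map (@proj1_sig X Gam) w) ->
        hclosure H' (lang (r e)) w.

Definition reduces_to_empty (X : Type) (H : hyps X) : Prop :=
  exists Gam : X -> Prop, reduces H (@no_hyps (sig Gam)).

(** * Kleene algebra with positive tests *)

Inductive tdl (Omega : Type) : Type :=
| Join of tdl Omega & tdl Omega
| Meet of tdl Omega & tdl Omega
| Gen of Omega.

Inductive dl_axiom (Omega : Type) : tdl Omega -> tdl Omega -> Prop :=
| dl_joinA p q s : dl_axiom (Join p (Join q s)) (Join (Join p q) s)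
| dl_meetA p q s : dl_axiom (Meet p (Meet q s)) (Meet (Meet p q) s)
| dl_joinC p q : dl_axiom (Join p q) (Join q p)
| dl_meetC p q : dl_axiom (Meet p q) (Meet q p)
| dl_joinI p : dl_axiom (Join p p) p
| dl_meetI p : dl_axiom (Meet p p) p
| dl_joinK p q : dl_axiom (Join p (Meet p q)) p
| dl_meetK p q : dl_axiom (Meet p (Join p q)) p
| dl_meetDr p q s : dl_axiom (Meet p (Join q s)) (Join (Meet p q) (Meet p s))
| dl_joinDr p q s : dl_axiom (Join p (Meet q s)) (Meet (Join p q) (Join p s)).

Section Kapt.
Variables Sigma Omega : Type.

(** The alphabet [Sigma + T_DL]: a whole lattice expression is one letter. *)
Definition kapt_letter : Type := (Sigma + tdl Omega)%type.

Definition test (phi : tdl Omega) : regex kapt_letter := Letter (inr phi).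

Inductive dl_equation : regex kapt_letter -> regex kapt_letter -> Prop :=
| DlEquation phi psi : dl_axiom phi psi -> dl_equation (test phi) (test psi).

Inductive glue_equation : regex kapt_letter -> regex kapt_letter -> Prop :=
| GlueMeet phi psi :
    glue_equation (test (Meet phi psi)) (test phi * test psi)
| GlueJoin phi psi :
    glue_equation (test (Join phi psi)) (test phi + test psi).

Inductive test_le_one : regex kapt_letter -> regex kapt_letter -> Prop :=
| TestLeOne phi : test_le_one (test phi) One.

Definition H_dl : hyps kapt_letter := of_equations dl_equation.

Definition H_kapt : hyps kapt_letter :=
  hypsU H_dl (hypsU (of_equations glue_equation) test_le_one).

End Kapt.

(** * Decidability

    Under classical axioms, the existence of a boolean characteristic function
    says nothing about a relation.  Decidability is therefore stated through a
    model of computation: the characteristic function is lambda-definable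
    (Church), i.e. computed up to beta-conversion by a closed term of the
    untyped lambda-calculus, on Scott encodings of the expressions. *)

(** De Bruijn indices, [Var 0] being bound by the innermost [Lam]. *)
Inductive term : Type :=
| Var of nat
| App of term & term
| Lam of term.

Fixpoint closed_at (k : nat) (t : term) : bool :=
  match t with
  | Var n => n < k
  | App t u => closed_at k t && closed_at k u
  | Lam t => closed_at k.+1 t
  end.

Definition closed_term (t : term) : bool := closed_at 0 t.

Fixpoint lift (k : nat) (t : term) : term :=
  match t with
  | Var n => Var (if n < k then n else n.+1)
  | App t u => App (lift k t) (lift k u)
  | Lam t => Lam (lift k.+1 t)
  end.

(** Replaces [Var k] by [u] and decrements the larger free variables. *)
Fixpoint subst (k : nat) (u : term) (t : term) : term :=
  match t with
  | Var n => if n < k then Var n else if n == k then u else Var n.-1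
  | App t1 t2 => App (subst k u t1) (subst k u t2)
  | Lam t => Lam (subst k.+1 (lift 0 u) t)
  end.

Inductive beta : term -> term -> Prop :=
| beta_redex t u : beta (App (Lam t) u) (subst 0 u t)
| beta_appl t t' u : beta t t' -> beta (App t u) (App t' u)
| beta_appr t u u' : beta u u' -> beta (App t u) (App t u')
| beta_lam t t' : beta t t' -> beta (Lam t) (Lam t').

Definition beta_conv : term -> term -> Prop := clos_refl_sym_trans term beta.

Definition lam_true : term := Lam (Lam (Var 1)).
Definition lam_false : term := Lam (Lam (Var 0)).

(** Scott encoding of the [i]-th of [n] constructors (counting from 0), applied
    to closed arguments: [\c_0 ... c_(n-1). c_i arg_1 ... arg_m]. *)
Definition scott (n i : nat) (args : seq term) : term :=
  iter n Lam (foldl App (Var (n - i.+1)) args).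

Fixpoint enc_nat (n : nat) : term :=
  match n with
  | 0 => scott 2 0 [::]
  | n.+1 => scott 2 1 [:: enc_nat n]
  end.

Definition enc_fin (T : finType) (x : T) : term := enc_nat (enum_rank x).

Fixpoint enc_tdl (Omega : finType) (phi : tdl Omega) : term :=
  match phi with
  | Join p q => scott 3 0 [:: enc_tdl p; enc_tdl q]
  | Meet p q => scott 3 1 [:: enc_tdl p; enc_tdl q]
  | Gen o => scott 3 2 [:: enc_fin o]
  end.

Definition enc_letter (Sigma Omega : finType) (x : kapt_letter Sigma Omega) :=
  match x with
  | inl a => scott 2 0 [:: enc_fin a]
  | inr phi => scott 2 1 [:: enc_tdl phi]
  end.

Fixpoint enc_regex (X : Type) (enc : X -> term) (e : regex X) : term :=
  match e with
  | Plus e f => scott 6 0 [:: enc_regex enc e; enc_regex enc f]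
  | Dot e f => scott 6 1 [:: enc_regex enc e; enc_regex enc f]
  | Star e => scott 6 2 [:: enc_regex enc e]
  | Zero => scott 6 3 [::]
  | One => scott 6 4 [::]
  | Letter a => scott 6 5 [:: enc a]
  end.

Definition decidable_rel (A : Type) (enc : A -> term) (R : A -> A -> Prop) :
    Prop :=
  exists2 t : term, closed_term t &
    forall x y : A,
      (R x y -> beta_conv (App (App t (enc x)) (enc y)) lam_true) /\
      (~ R x y -> beta_conv (App (App t (enc x)) (enc y)) lam_false).

(* Main.v *)
From HB Require Import structures.
Require Import Defs.
From mathcomp Require Import all_boot.
From mathcomp Require Import boolp.
From Stdlib Require Import Setoid Morphisms Relation_Operators.

Set Implicit Arguments.
Unset Strict Implicit.
Unset Printing Implicit Defensive.

(** Expressions are interpreted by languages of guarded strings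
    [S_0 a_1 S_1 ... a_n S_n], where the guards [S_i] are arbitrary subsets of
    [Omega] and a test accepts the guards satisfying it.  This interpretation
    is sound for [KA_H], and the [H]-closure of [lang e] only contains words all
    of whose guarded strings belong to [glang e].

    For every [f] there is a deterministic automaton for [glang f] whose states
    [q] carry expressions [R q], with [R (start) <= f], that provably dominate
    what is accepted from [q].  By induction on [e], if all guarded strings of
    [e] lead to states where the automaton accepts, then [e <= R (start)] is
    derivable; hence [glang e] included in [glang f] gives [e <= f].  Applied to
    the least solution of the automaton of [e], written with the letters of
    [Sigma] and [Omega] only, the same induction shows that [e] equals that
    solution, which is the reduction.

    Finally, [glang e = glang f] is decided by comparing derivatives up to a
    depth bounded by the product of the numbers of states; all the functions
    involved are structurally recursive, hence computed by closed terms built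
    from Scott encodings and Turing's fixpoint combinator. *)

(** * Kleene algebra with hypotheses *)

Section KleeneAlgebra.
Variables (X : Type) (H : hyps X).
Implicit Types e f g x y z : regex X.
Local Open Scope regex_scope.

Definition kle e f := ka H (e + f) f.
Local Notation "e <== f" := (kle e f) (at level 70).

#[global] Instance ka_equivalence : Equivalence (ka H).
Proof.
by split; [exact: ka_refl | exact: ka_sym | exact: ka_trans].
Qed.

#[global] Instance Plus_ka_Proper :
  Proper (ka H ==> ka H ==> ka H) (@Plus X).
Proof. by move=> ? ? ? ? ? ?; exact: ka_plus. Qed.

#[global] Instance Dot_ka_Proper : Proper (ka H ==> ka H ==> ka H) (@Dot X).
Proof. by move=> ? ? ? ? ? ?; exact: ka_dot. Qed.

#[global] Instance Star_ka_Proper : Proper (ka H ==> ka H) (@Star X).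
Proof. by move=> ? ? ?; exact: ka_star. Qed.

#[global] Instance kle_ka_Proper : Proper (ka H ==> ka H ==> iff) kle.
Proof.
by move=> e e' ee' f f' ff'; rewrite /kle; split=> h;
   [rewrite -ee' -ff' | rewrite ee' ff'].
Qed.

Hint Resolve ka_refl : core.

Lemma kle_refl e : e <== e. Proof. exact: ka_plusI. Qed.
Hint Resolve kle_refl : core.

Lemma kle_trans f e g : e <== f -> f <== g -> e <== g.
Proof. by rewrite /kle => ef fg; rewrite -fg ka_plusA ef. Qed.

Lemma ka_kle e f : ka H e f -> e <== f.
Proof. by move=> ->. Qed.

Lemma kle_antisym e f : e <== f -> f <== e -> ka H e f.
Proof. by rewrite /kle => ef fe; rewrite -ef ka_plusC fe. Qed.

Lemma kle_hyp e f : H e f -> e <== f.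
Proof. exact: ka_hyp. Qed.

Lemma kle_plusl e f : e <== e + f.
Proof. by rewrite /kle ka_plusA ka_plusI. Qed.

Lemma kle_plusr e f : f <== e + f.
Proof. by rewrite ka_plusC; exact: kle_plusl. Qed.

Lemma kle_plus_lub e f g : e <== g -> f <== g -> e + f <== g.
Proof. by rewrite /kle => eg fg; rewrite -ka_plusA fg. Qed.

Lemma kle_zero e : 0 <== e.
Proof. by rewrite /kle ka_plusC ka_plus0. Qed.

Lemma kle_plus e e' f f' : e <== e' -> f <== f' -> e + f <== e' + f'.
Proof.
move=> ee' ff'; apply: kle_plus_lub.
- exact: kle_trans ee' (kle_plusl _ _).
- exact: kle_trans ff' (kle_plusr _ _).
Qed.

Lemma kle_dot e e' f f' : e <== e' -> f <== f' -> e * f <== e' * f'.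
Proof.
move=> ee' ff'; apply: (@kle_trans (e' * f)).
- by rewrite /kle -ka_dotDl ee'.
- by rewrite /kle -ka_dotDr ff'.
Qed.

Lemma kle_dotl e f f' : f <== f' -> e * f <== e * f'.
Proof. exact: kle_dot. Qed.

Lemma kle_dotr e e' f : e <== e' -> e * f <== e' * f.
Proof. by move=> ee'; exact: kle_dot. Qed.

Lemma kle_dotlub e f g x : e * g <== x -> f * g <== x -> (e + f) * g <== x.
Proof. by rewrite ka_dotDl; exact: kle_plus_lub. Qed.

Lemma kle_lubdot e f g x : g * e <== x -> g * f <== x -> g * (e + f) <== x.
Proof. by rewrite ka_dotDr; exact: kle_plus_lub. Qed.

Lemma kle_star_unfold e : 1 + e * Star e <== Star e.
Proof. exact: ka_star_unfold. Qed.

Lemma kle_star1 e : 1 <== Star e.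
Proof. exact: kle_trans (kle_plusl _ _) (kle_star_unfold e). Qed.

Lemma kle_starS e : e * Star e <== Star e.
Proof. exact: kle_trans (kle_plusr _ _) (kle_star_unfold e). Qed.

Lemma kle_star_indl x y z : x <== z -> y * z <== z -> Star y * x <== z.
Proof. by move=> xz yz; apply: ka_star_indl; exact: kle_plus_lub. Qed.

Lemma kle_star_indr x y z : x <== y -> y * z <== y -> x * Star z <== y.
Proof. by move=> xz yz; apply: ka_star_indr; exact: kle_plus_lub. Qed.

Lemma kle_star_star e : Star e * Star e <== Star e.
Proof. by apply: kle_star_indl => //; exact: kle_starS. Qed.

Lemma kle_star_incl e : e <== Star e.
Proof.
rewrite -{1}(ka_dot1r H e).
by apply: kle_trans (kle_starS e); apply: kle_dotl; exact: kle_star1.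
Qed.

Lemma kle_star_one e : e <== 1 -> Star e <== 1.
Proof.
by move=> e1; rewrite -(ka_dot1r H (Star e)); apply: kle_star_indl;
  rewrite ?ka_dot1r.
Qed.

Lemma kle_mul1l e f x : e <== 1 -> f <== x -> e * f <== x.
Proof. by move=> e1 fx; rewrite -(ka_dot1l H x); exact: kle_dot. Qed.

Lemma kle_mul1r e f x : f <== 1 -> e <== x -> e * f <== x.
Proof. by move=> e1 fx; rewrite -(ka_dot1r H x); exact: kle_dot. Qed.

Lemma kle_1mull e f x : 1 <== e -> x <== f -> x <== e * f.
Proof. by move=> e1 fx; rewrite -(ka_dot1l H x); exact: kle_dot. Qed.

Lemma kle_1mulr e f x : 1 <== f -> x <== e -> x <== e * f.
Proof. by move=> e1 fx; rewrite -(ka_dot1r H x); exact: kle_dot. Qed.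

Definition csum (I : Type) (F : I -> regex X) (s : seq I) : regex X :=
  foldr (fun i e => F i + e) 0 s.

Lemma csum_lub (I : eqType) (F : I -> regex X) (s : seq I) x :
  (forall i, i \in s -> F i <== x) -> csum F s <== x.
Proof.
elim: s => [|i s IHs] /= Fx; first exact: kle_zero.
apply: kle_plus_lub; first by apply: Fx; rewrite mem_head.
by apply: IHs => j js; apply: Fx; rewrite in_cons js orbT.
Qed.

Lemma csum_ub (I : eqType) (F : I -> regex X) (s : seq I) i :
  i \in s -> F i <== csum F s.
Proof.
elim: s => //= j s IHs; rewrite in_cons => /predU1P[->|/IHs Fi].
- exact: kle_plusl.
- exact: kle_trans Fi (kle_plusr _ _).
Qed.

Lemma csum_dot_lub (I : eqType) (F : I -> regex X) (s : seq I) g x :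
  (forall i, i \in s -> F i * g <== x) -> csum F s * g <== x.
Proof.
elim: s => [|i s IHs] /= Fx; first by rewrite ka_dot0l; exact: kle_zero.
apply: kle_dotlub; first by apply: Fx; rewrite mem_head.
by apply: IHs => j js; apply: Fx; rewrite in_cons js orbT.
Qed.

Lemma dot_csum_lub (I : eqType) (F : I -> regex X) (s : seq I) g x :
  (forall i, i \in s -> g * F i <== x) -> g * csum F s <== x.
Proof.
elim: s => [|i s IHs] /= Fx; first by rewrite ka_dot0r; exact: kle_zero.
apply: kle_lubdot; first by apply: Fx; rewrite mem_head.
by apply: IHs => j js; apply: Fx; rewrite in_cons js orbT.
Qed.

(** * Matrices of regular expressions and their star *)

Variables (Q : finType) (M : Q -> Q -> regex X).

(* Kleene's path expressions: nonempty paths from [i] to [j] all of whose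
   intermediate states lie in [s]. *)
Fixpoint kpath (s : seq Q) (i j : Q) : regex X :=
  if s is k :: s' then
    kpath s' i j + kpath s' i k * (Star (kpath s' k k) * kpath s' k j)
  else M i j.

Definition mstar (i j : Q) : regex X :=
  (if i == j then 1 else 0) + kpath (enum Q) i j.

Lemma kpath_incl s i j : M i j <== kpath s i j.
Proof.
by elim: s => [|k s IHs] //=; apply: kle_trans IHs (kle_plusl _ _).
Qed.

(** With [l] as new pivot, a path through it is an entry, a loop in [L] and an exit. Pieces meeting
    at [l], or at a state of [s] by induction, merge because [L * L <== L]. *)
Lemma kpath_cat s i j k : k \in s -> kpath s i k * kpath s k j <== kpath s i j.
Proof.
elim: s i j k => //= l s IHs i j k.
set P := kpath s in IHs *; pose L := Star (P l l).
have via i' j' : P i' l * (L * P l j') <==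
    P i' j' + P i' l * (L * P l j') by exact: kle_plusr.
have PlL j' : P l l * (L * P l j') <== L * P l j'.
  by rewrite ka_dotA; apply: kle_dotr; exact: kle_starS.
have LPl i' : P i' l * L * P l l <== P i' l * L.
  rewrite -ka_dotA; apply: kle_dotl.
  apply: kle_trans (kle_star_star _); apply: kle_dotl; exact: kle_star_incl.
have left j' : P l j' + P l l * (L * P l j') <== L * P l j'.
  apply: kle_plus_lub => //.
  by apply: kle_1mull => //; exact: kle_star1.
have right i' : P i' l + P i' l * (L * P l l) <== P i' l * L.
  apply: kle_plus_lub; last by rewrite ka_dotA.
  by apply: kle_1mulr => //; exact: kle_star1.
rewrite in_cons => /predU1P[->|ks].
  apply: kle_trans (via i j).
  apply: kle_trans (kle_dot (right i) (left j)) _.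
  rewrite -ka_dotA; apply: kle_dotl; rewrite ka_dotA; apply: kle_dotr.
  exact: kle_star_star.
apply: kle_dotlub; apply: kle_lubdot.
- exact: kle_trans (IHs _ _ _ ks) (kle_plusl _ _).
- apply: kle_trans (via i j); rewrite ka_dotA; apply: kle_dotr; exact: IHs.
- apply: kle_trans (via i j); rewrite -!ka_dotA.
  by do 2 apply: kle_dotl; exact: IHs.
(* Both halves visit [l]: by induction the piece from [l] to [k] and back is a single loop at [l],
   absorbed by [L]. *)
- apply: kle_trans (via i j); rewrite -!ka_dotA; apply: kle_dotl.
  rewrite !(ka_dotA _ _ _ (P l j)) !ka_dotA; apply: kle_dotr.
  rewrite -(ka_dotA _ L (P l k)).
  apply: (@kle_trans (L * P l l * L)).
    by apply: kle_dotr; apply: kle_dotl; exact: IHs.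
  apply: kle_trans (kle_star_star _); apply: kle_dotr.
  apply: kle_trans (kle_star_star _); apply: kle_dotl; exact: kle_star_incl.
Qed.

(** The star at each pivot is removed by left induction. With its dual for rows, this yields the
    leastness of the star of [M]. *)
Lemma kpath_col s (x : Q -> regex X) :
  (forall i j, M i j * x j <== x i) -> forall i j, kpath s i j * x j <== x i.
Proof.
move=> Mx; elim: s => //= k s IHs i j; apply: kle_dotlub => //.
rewrite -!ka_dotA; apply: kle_trans (IHs i k); apply: kle_dotl.
exact: kle_star_indl.
Qed.

Lemma kpath_row s (x : Q -> regex X) :
  (forall i j, x i * M i j <== x j) -> forall i j, x i * kpath s i j <== x j.
Proof.
move=> Mx; elim: s => //= k s IHs i j; apply: kle_lubdot => //.
rewrite !ka_dotA; apply: kle_trans (IHs k j); apply: kle_dotr.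
exact: kle_star_indr.
Qed.

Lemma mstar1 i : 1 <== mstar i i.
Proof. by rewrite /mstar eqxx; exact: kle_plusl. Qed.

Lemma mstar_incl i j : M i j <== mstar i j.
Proof. exact: kle_trans (kpath_incl _ _ _) (kle_plusr _ _). Qed.

Lemma mstar_cat i j k : mstar i j * mstar j k <== mstar i k.
Proof.
rewrite {1 2}/mstar; apply: kle_dotlub.
  case: eqP => [->|_]; last by rewrite ka_dot0l; exact: kle_zero.
  by rewrite ka_dot1l.
apply: kle_lubdot.
  case: eqP => [->|_]; last by rewrite ka_dot0r; exact: kle_zero.
  by rewrite ka_dot1r; exact: kle_plusr.
by apply: kle_trans (kle_plusr _ _); apply: kpath_cat; rewrite mem_enum.
Qed.

Lemma mstar_col (x : Q -> regex X) :
  (forall i j, M i j * x j <== x i) -> forall i j, mstar i j * x j <== x i.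
Proof.
move=> Mx i j; apply: kle_dotlub; last exact: kpath_col.
case: eqP => [->|_]; last by rewrite ka_dot0l; exact: kle_zero.
by rewrite ka_dot1l.
Qed.

Lemma mstar_row (x : Q -> regex X) :
  (forall i j, x i * M i j <== x j) -> forall i j, x i * mstar i j <== x j.
Proof.
move=> Mx i j; apply: kle_lubdot; last exact: kpath_row.
case: eqP => [->|_]; last by rewrite ka_dot0r; exact: kle_zero.
by rewrite ka_dot1r.
Qed.

End KleeneAlgebra.

(* Renaming of letters, and soundness for word languages *)
#[global] Hint Resolve ka_refl kle_refl : core.

(** Carries derivations without hypotheses over a smaller alphabet into a theory with hypotheses. *)
Lemma ka_map (X Y : Type) (h : X -> Y) (H : hyps X) (K : hyps Y) e f :
  (forall e f, H e f -> kle K (map_regex h e) (map_regex h f)) ->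
  ka H e f -> ka K (map_regex h e) (map_regex h f).
Proof.
move=> HK; elim=> {e f} /=; try by move=> *; constructor.
- by move=> e f g _ ef _; exact: ka_trans.
- by move=> e f /HK.
Qed.

Lemma map_csum (X Y I : Type) (h : X -> Y) (F : I -> regex X) s :
  map_regex h (csum F s) = csum (map_regex h \o F) s.
Proof. by elim: s => //= i s ->. Qed.

Lemma map_mstar (X Y : Type) (h : X -> Y) (Q : finType) (M : Q -> Q -> regex X)
    i j :
  map_regex h (mstar M i j) = mstar (fun i j => map_regex h (M i j)) i j.
Proof.
rewrite /mstar /=; congr Plus; first by case: eqP.
by elim: (enum Q) i j => //= k s IHs i j; rewrite !IHs.
Qed.

(** Lets membership of a word be proved through derivable inequations, as done below for solutions
    of automata. *)
Lemma ka_lang (X : Type) (e f : regex X) :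
  ka (@no_hyps X) e f -> forall w, lang e w <-> lang f w.
Proof.
elim=> {e f} //=; try by move=> *; tauto.
- by move=> e f _ ef w; rewrite ef.
- by move=> e f g _ ef _ fg w; rewrite ef fg.
- by move=> e e' f f' _ ee' _ ff' w; rewrite ee' ff'.
- move=> e e' f f' _ ee' _ ff' w.
  by split=> -[u [v [-> eu fv]]]; exists u, v; split=> //;
    [rewrite -ee' | rewrite -ff' | rewrite ee' | rewrite ff'].
- by move=> e e' _ ee' w; split; elim=> [|u v eu _ IH];
    [exact: star_nil | apply: star_app; rewrite // -?ee' | exact: star_nil
    | apply: star_app; rewrite // ?ee'].
- move=> e f g w; split.
    by move=> [u [_ [-> eu [v [x [-> fv gx]]]]]]; exists (u ++ v), x;
      rewrite catA; split=> //; exists u, v.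
  by move=> [_ [x [-> [u [v [-> eu fv]]] gx]]]; exists u, (v ++ x);
    rewrite catA; split=> //; exists v, x.
- by move=> e w; split=> [[u [v [-> -> ?]]]|?] //; exists [::], w.
- by move=> e w; split=> [[u [v [-> ? ->]]]|?]; rewrite ?cats0 //;
    exists w, [::]; rewrite cats0.
- by move=> e w; split=> // -[u [v []]].
- by move=> e w; split=> // -[u [v []]].
- move=> e f g w; split.
    by move=> [u [v [-> [eu|fu] gv]]]; [left|right]; exists u, v.
  by move=> [|] [u [v [-> eu gv]]]; exists u, v; split=> //; [left|right].
- move=> e f g w; split.
    by move=> [u [v [-> eu [fv|gv]]]]; [left|right]; exists u, v.
  by move=> [|] [u [v [-> eu gv]]]; exists u, v; split=> //; [left|right].
- move=> e w; split; last by right.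
  case=> // -[->|[u [v [-> eu ev]]]]; first exact: star_nil.
  exact: star_app.
- move=> x y z _ IH w; split; last by right.
  case=> // -[u [v [-> yu xv]]].
  have xz t : lang x t -> lang z t by move=> xt; rewrite -IH; left; left.
  have yzz s t : lang y s -> lang z t -> lang z (s ++ t).
    by move=> ys zt; rewrite -IH; left; right; exists s, t.
  elim: yu => [|s t ys _ zt] /=; first exact: xz.
  by rewrite -catA; exact: yzz.
- move=> x y z _ IH w; split; last by right.
  case=> // -[u [v [-> xu zv]]].
  have xy t : lang x t -> lang y t by move=> xt; rewrite -IH; left; left.
  have yz s t : lang y s -> lang z t -> lang y (s ++ t).
    by move=> ys zt; rewrite -IH; left; right; exists s, t.
  have {x xu xy IH} yu := xy _ xu.
  elim: zv u yu => [|s t zs _ zt] u yu; first by rewrite cats0.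
  by rewrite catA; apply: zt; exact: yz.
Qed.

Lemma kle_lang (X : Type) (e f : regex X) w :
  kle (@no_hyps X) e f -> lang e w -> lang f w.
Proof. by move=> /ka_lang <- ew; left. Qed.

(** * Guarded strings *)

Section GuardedStrings.
Variables (Sigma Omega : finType).
Local Notation letter := (kapt_letter Sigma Omega).
Local Notation guard := {set Omega}.
Implicit Types (e f g : regex letter) (S T : guard).

Fixpoint sat S (phi : tdl Omega) : bool :=
  match phi with
  | Join p q => sat S p || sat S q
  | Meet p q => sat S p && sat S q
  | Gen o => o \in S
  end.

Lemma satS S T phi : S \subset T -> sat S phi -> sat T phi.
Proof.
move=> ST; elim: phi => [p IHp q IHq|p IHp q IHq|o] /=.
- by case/orP=> [/IHp|/IHq] ->; rewrite ?orbT.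
- by case/andP=> /IHp -> /IHq ->.
- exact: (subsetP ST).
Qed.

Lemma sat_dl S phi psi : dl_axiom phi psi -> sat S phi = sat S psi.
Proof.
by case=> * /=; do ?[case: (sat S _) => //=]; rewrite ?andbb ?orbb.
Qed.

(* The guarded string S_0 a_1 S_1 ... a_n S_n is represented by the pair of
   [:: (S_0, a_1); ...; (S_(n-1), a_n)] and S_n; its first guard is [hd]. *)
Definition glanguage := seq (guard * Sigma) -> guard -> Prop.

Definition hd (u : seq (guard * Sigma)) S := if u is c :: _ then c.1 else S.

Lemma hd_cat u v S : hd (u ++ v) S = hd u (hd v S).
Proof. by case: u. Qed.

Lemma hd_sub u S T : S \subset T -> hd u S \subset hd u T.
Proof. by case: u. Qed.

(** Fusion product: the last guard of the left factor must be the first guard [hd w S] of the right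
    one. *)
Definition gdot (L K : glanguage) : glanguage :=
  fun u S => exists v w, [/\ u = v ++ w, L v (hd w S) & K w S].

Inductive gstar (L : glanguage) : glanguage :=
| gstar_nil S : gstar L [::] S
| gstar_app u v S : L u (hd v S) -> gstar L v S -> gstar L (u ++ v) S.

Fixpoint glang (e : regex letter) : glanguage :=
  match e with
  | Plus e f => fun u S => glang e u S \/ glang f u S
  | Dot e f => gdot (glang e) (glang f)
  | Star e => gstar (glang e)
  | Zero => fun _ _ => False
  | One => fun u _ => u = [::]
  | Letter (inl a) => fun u _ => exists T, u = [:: (T, a)]
  | Letter (inr phi) => fun u S => u = [::] /\ sat S phi
  end.

(** Tests have no complements, hence are monotone in the guard. In a product, the last guard of the
    left factor grows with [S] if the right factor has no action, and is fixed otherwise. *)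
Lemma glangS e u S T : S \subset T -> glang e u S -> glang e u T.
Proof.
elim: e u S T => [e IHe f IHf|e IHe f IHf|e IHe|||[a|phi]] u S T ST //=.
- by move=> [/(IHe _ _ _ ST)|/(IHf _ _ _ ST)]; [left|right].
- move=> [v [w [-> ev fw]]]; exists v, w; split=> //.
    by apply: IHe ev; exact: hd_sub.
  exact: IHf fw.
- move=> eu; elim: eu T ST => [*|v w {}S ev _ IH T ST]; first exact: gstar_nil.
  by apply: gstar_app (IH _ ST); apply: IHe ev; exact: hd_sub.
- by move=> [-> /(satS ST)].
Qed.

Lemma gstar_cat L u v S :
  gstar L u (hd v S) -> gstar L v S -> gstar L (u ++ v) S.
Proof.
move: {-2}(hd v S) (erefl (hd v S)) => T TE uT.
elim: uT TE => //= {T}u w T Lu _ IH TE vS; rewrite -catA.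
by apply: gstar_app (IH TE vS); rewrite hd_cat -TE.
Qed.

Lemma gdotA L K M u S : gdot L (gdot K M) u S <-> gdot (gdot L K) M u S.
Proof.
split.
  move=> [v [wx [-> Lv [w [x [wxE Kw Mx]]]]]]; move: Lv; rewrite wxE => Lv.
  exists (v ++ w), x.
  by rewrite catA; split=> //; exists v, w; rewrite -hd_cat.
move=> [vw [x [-> [v [w [-> Lv Kw]]] Mx]]]; exists v, (w ++ x).
by rewrite hd_cat catA; split=> //; exists w, x.
Qed.

(** [sat S] is a lattice homomorphism, and fusing two strings without actions keeps a single guard,
    so a product of tests acts as a conjunction. *)
Lemma glang_hyp e f u S :
  @H_kapt Sigma Omega e f -> glang e u S -> glang f u S.
Proof.
have eq e' f' : dl_equation e' f' -> glang e' u S <-> glang f' u S.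
  by case=> phi psi /(sat_dl S) /= ->.
have glue e' f' : glue_equation e' f' -> glang e' u S <-> glang f' u S.
  case=> phi psi /=.
    split=> [[-> /andP[Sp Sq]]|[v [w [-> [-> Sp] [w0 Sq]]]]].
      by exists [::], [::].
    by rewrite w0 in Sp *; split=> //; rewrite Sp Sq.
  split=> [[-> /orP[Sp|Sq]]|]; [by left | by right |].
  by case=> [[-> ->]|[-> ->]]; rewrite ?orbT.
case=> [[/eq->|/eq->]|[[/glue->|/glue->]|]] //.
by case=> phi [].
Qed.

Lemma ka_glang e f :
  ka (@H_kapt Sigma Omega) e f -> forall u S, glang e u S <-> glang f u S.
Proof.
elim=> {e f} //=; try by move=> *; tauto.
- by move=> e f _ ef u S; rewrite ef.
- by move=> e f g _ ef _ fg u S; rewrite ef fg.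
- by move=> e e' f f' _ ee' _ ff' u S; rewrite ee' ff'.
- move=> e e' f f' _ ee' _ ff' u S.
  by split=> -[v [w [-> ev fw]]]; exists v, w; split=> //;
    [rewrite -ee' | rewrite -ff' | rewrite ee' | rewrite ff'].
- by move=> e e' _ ee' u S; split; elim=> [{}S|{}u v {}S eu _ IH];
    [exact: gstar_nil | apply: gstar_app; rewrite // -?ee' | exact: gstar_nil
    | apply: gstar_app; rewrite // ?ee'].
- move=> e f g u S; exact: gdotA.
- by move=> e u S; split=> [[v [w [-> -> ?]]]|?] //; exists [::], u.
- by move=> e u S; split=> [[v [w [-> + w0]]]|?];
    [rewrite w0 cats0 | exists u, [::]; rewrite cats0].
- by move=> e u S; split=> // -[v [w []]].
- by move=> e u S; split=> // -[v [w []]].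
- move=> e f g u S; split.
    by move=> [v [w [-> [ev|fv] gw]]]; [left|right]; exists v, w.
  by move=> [|] [v [w [-> ev gw]]]; exists v, w; split=> //; [left|right].
- move=> e f g u S; split.
    by move=> [v [w [-> ev [fw|gw]]]]; [left|right]; exists v, w.
  by move=> [|] [v [w [-> ev gw]]]; exists v, w; split=> //; [left|right].
- move=> e u S; split; last by right.
  case=> // -[->|[v [w [-> ev ew]]]]; first exact: gstar_nil.
  exact: gstar_app.
- move=> x y z _ IH u S; split; last by right.
  case=> // -[v [w [-> yv xw]]].
  have zw : glang z w S by rewrite -IH; left; left.
  have yz s t : glang y s (hd t S) -> glang z t S -> glang z (s ++ t) S.
    by move=> ys zt; rewrite -IH; left; right; exists s, t.
  (* The guard where the two parts meet is generalised, being an index of [gstar]. *)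
  move: {-2}(hd w S) (erefl (hd w S)) yv => T TE yv.
  elim: yv TE => //= {}v v' {xw}T yv _ IHv TE; rewrite -catA.
  by apply: yz (IHv TE); rewrite hd_cat -TE.
- move=> x y z _ IH u S; split; last by right.
  case=> // -[v [w [-> xv zw]]].
  have yv : glang y v (hd w S) by rewrite -IH; left; left.
  have yz s t T : glang y s (hd t T) -> glang z t T -> glang y (s ++ t) T.
    by move=> ys zt; rewrite -IH; left; right; exists s, t.
  elim: zw v yv {xv} => [{}S v|w' w'' {}S zw' _ IHw v yv]; first by rewrite cats0.
  by rewrite catA; apply: IHw; apply: yz => //; rewrite -hd_cat.
- by move=> e f ef u S; split=> [[/(glang_hyp ef)|]|] //; right.
Qed.

Lemma kle_glang e f u S :
  kle (@H_kapt Sigma Omega) e f -> glang e u S -> glang f u S.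
Proof. by move=> /ka_glang <- eu; left. Qed.

Fixpoint gword (w : seq letter) : glanguage :=
  if w is x :: w' then gdot (glang (Letter x)) (gword w')
  else fun u _ => u = [::].

Lemma gword_cat v w u S : gword (v ++ w) u S <-> gdot (gword v) (gword w) u S.
Proof.
elim: v u S => [|x v IHv] u S /=.
  by split=> [?|[? [? [-> -> ?]]]] //; exists [::], u.
rewrite -gdotA; split=> -[u1 [u2 [-> xu1 vu2]]]; exists u1, u2;
  by split=> //; apply/IHv.
Qed.

(** Bridge from words to guarded strings: [glang e] depends on [lang e] only. *)
Lemma glangP e u S : glang e u S <-> exists2 w, lang e w & gword w u S.
Proof.
elim: e u S => [e IHe f IHf|e IHe f IHf|e IHe|||x] u S /=.
- rewrite IHe IHf; split; last by move=> [w [ew|fw] wu]; [left|right]; exists w.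
  by move=> [[w ew wu]|[w fw wu]]; exists w => //; [left|right].
- split.
    move=> [v [v' [-> /IHe[w ew wv] /IHf[w' fw' wv']]]].
    exists (w ++ w'); first by exists w, w'.
    by apply/gword_cat; exists v, v'.
  move=> [_ [w [w' [-> ew fw']]] /gword_cat[v [v' [-> wv wv']]]].
  by exists v, v'; split=> //; [apply/IHe; exists w | apply/IHf; exists w'].
- split.
    elim=> [{}S|v v' {}S /IHe[w ew wv] _ [w' ew' wv']].
      by exists [::]; first exact: star_nil.
    exists (w ++ w'); first exact: star_app.
    by apply/gword_cat; exists v, v'.
  move=> [w ew]; elim: ew u S => [u S ->|w1 w2 ew1 _ IH u S].
    exact: gstar_nil.
  move=> /gword_cat[v [v' [-> wv wv']]]; apply: gstar_app; last exact: IH.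
  by apply/IHe; exists w1.
- by split=> // -[].
- by split=> [->|[w ->]] //; exists [::].
- split=> [xu|[w -> [v [v' [-> + v'0]]]]]; last by rewrite v'0 cats0.
  by exists [:: x] => //; exists u, [::]; rewrite cats0.
Qed.

(** The words whose guarded strings all lie in [glang e] include [lang e] and are closed under each
    hypothesis, by [glang_hyp] on the middle factor. *)
Lemma hclosure_gword e w :
  hclosure (@H_kapt Sigma Omega) (lang e) w ->
  forall u S, gword w u S -> glang e u S.
Proof.
elim=> {w} [w ew|f f' u v ff' _ IH w fw] x S.
  by move=> wx; apply/glangP; exists w.
move=> /gword_cat[x1 [x' [xE ux1 x'E]]].
move: x'E => /gword_cat[x2 [x3 [x'E wx2 vx3]]].
rewrite {x}xE {x'}x'E in ux1 *.
have /glangP[w' fw' wx2'] : glang f' x2 (hd x3 S).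
  by apply: glang_hyp ff' _; apply/glangP; exists w.
apply: (IH w' fw'); apply/gword_cat; exists x1, (x2 ++ x3); split=> //.
by apply/gword_cat; exists x2, x3.
Qed.

End GuardedStrings.

(** * Tests and automata *)

Section Tests.
Variables (Sigma Omega : finType).
Local Notation letter := (kapt_letter Sigma Omega).
Local Notation guard := {set Omega}.
Local Notation "e <== f" := (kle (@H_kapt Sigma Omega) e f) (at level 70).
Local Notation test := (@test Sigma Omega).
Implicit Types (e f g x : regex letter) (S T : guard) (phi psi : tdl Omega).
Local Open Scope regex_scope.

Lemma test_le1 phi : test phi <== 1.
Proof. by apply: kle_hyp; right; right. Qed.

Lemma test_dl phi psi : dl_axiom phi psi -> test phi <== test psi.
Proof. by move=> pq; apply: kle_hyp; left; left; constructor. Qed.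

Lemma test_ld phi psi : dl_axiom phi psi -> test psi <== test phi.
Proof. by move=> pq; apply: kle_hyp; left; right; constructor. Qed.

Lemma test_meet phi psi : test (Meet phi psi) <== test phi * test psi.
Proof. by apply: kle_hyp; right; left; left; constructor. Qed.

Lemma test_meetV phi psi : test phi * test psi <== test (Meet phi psi).
Proof. by apply: kle_hyp; right; left; right; constructor. Qed.

Lemma test_join phi psi : test (Join phi psi) <== test phi + test psi.
Proof. by apply: kle_hyp; right; left; left; constructor. Qed.

Lemma test_joinV phi psi : test phi + test psi <== test (Join phi psi).
Proof. by apply: kle_hyp; right; left; right; constructor. Qed.

Lemma test_comm phi psi : test phi * test psi <== test psi * test phi.
Proof.
apply: kle_trans (test_meetV _ _) _; apply: kle_trans (test_meet _ _).
by apply: test_dl; constructor.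
Qed.

Lemma test_idem phi : test phi <== test phi * test phi.
Proof.
by apply: kle_trans (test_meet _ _); apply: test_ld; constructor.
Qed.

Definition gens (s : seq Omega) : regex letter :=
  foldr (fun o e => test (Gen o) * e) 1 s.

(** A product rather than a lattice expression: [tdl] has no top element to serve as empty
    conjunction, whereas [atom set0] is [1]. *)
Definition atom S := gens (enum S).

Lemma gens_le1 s : gens s <== 1.
Proof.
elim: s => //= o s IHs; apply: kle_mul1l => //; exact: test_le1.
Qed.

Lemma gens_mem s o : o \in s -> gens s <== test (Gen o) * gens s.
Proof.
elim: s => //= p s IHs; rewrite in_cons => /predU1P[->|/IHs os].
  by rewrite ka_dotA; apply: kle_dotr; exact: test_idem.
apply: kle_trans (kle_dotl _ os) _; rewrite !ka_dotA.
by apply: kle_dotr; exact: test_comm.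
Qed.

(** Each generator of [t] is duplicated inside [gens s] by idempotence and brought to the front by
    commutation. *)
Lemma gens_absorb s t : {subset t <= s} -> gens s <== gens t * gens s.
Proof.
elim: t => [|o t IHt] ts /=; first by rewrite ka_dot1l.
have /IHt IH : {subset t <= s} by move=> p pt; apply: ts; rewrite in_cons pt orbT.
apply: kle_trans (gens_mem (ts o (mem_head _ _))) _.
by rewrite -ka_dotA; apply: kle_dotl.
Qed.

Lemma gens_sub s t : {subset t <= s} -> gens s <== gens t.
Proof.
move=> /gens_absorb st; apply: kle_trans st _.
by apply: kle_mul1r => //; exact: gens_le1.
Qed.

Lemma gens_cat s t : ka (@H_kapt Sigma Omega) (gens (s ++ t)) (gens s * gens t).
Proof.
elim: s => [|o s IHs] /=; first by rewrite ka_dot1l.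
by rewrite IHs ka_dotA.
Qed.

Lemma atom0 : 1 <== atom set0.
Proof. by rewrite /atom enum_set0. Qed.

Lemma atom_idem S : atom S <== atom S * atom S.
Proof. exact: gens_absorb. Qed.

Lemma atom_sat S phi : sat S phi -> atom S <== test phi.
Proof.
elim: phi => [p IHp q IHq|p IHp q IHq|o] /=.
- move=> S_pq; apply: kle_trans (test_joinV _ _).
  case/orP: S_pq => [/IHp Sp|/IHq Sq].
    exact: kle_trans Sp (kle_plusl _ _ _).
  exact: kle_trans Sq (kle_plusr _ _ _).
- move=> /andP[/IHp Sp /IHq Sq]; apply: kle_trans (test_meetV _ _).
  by apply: kle_trans (atom_idem S) _; exact: kle_dot.
- move=> oS; apply: (@kle_trans _ _ (gens [:: o])).
    by apply: gens_sub => p; rewrite inE mem_enum => /eqP ->.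
  by rewrite /= ka_dot1r.
Qed.

(* Without complements, [atom S] below a test does not exclude larger atoms:
   only the sum over all [T] containing [S] recovers [atom S * test phi]. *)
Lemma atom_test_lub S phi g x :
  (forall T, S \subset T -> sat T phi -> atom T * g <== x) ->
  atom S * test phi * g <== x.
Proof.
elim: phi S g => [p IHp q IHq|p IHp q IHq|o] S g /= leT.
- apply: (@kle_trans _ _ (atom S * (test p + test q) * g)).
    by apply: kle_dotr; apply: kle_dotl; exact: test_join.
  rewrite ka_dotDr; apply: kle_dotlub.
    by apply: IHp => T ST Tp; apply: leT; rewrite // Tp.
  by apply: IHq => T ST Tq; apply: leT; rewrite // Tq orbT.
- apply: (@kle_trans _ _ (atom S * test p * (test q * g))).
    rewrite !ka_dotA; apply: kle_dotr; rewrite -ka_dotA.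
    by apply: kle_dotl; exact: test_meet.
  apply: IHp => T ST Tp; rewrite ka_dotA; apply: IHq => U TU Uq.
  by apply: leT; [exact: subset_trans TU | rewrite (satS TU Tp)].
- apply: (@kle_trans _ _ (atom (o |: S) * g)); last first.
    by apply: leT; [exact: subsetUr | rewrite setU11].
  apply: kle_dotr; apply: (@kle_trans _ _ (gens (enum S ++ [:: o]))).
    by rewrite gens_cat /= ka_dot1r.
  apply: gens_sub => p; rewrite mem_cat !mem_enum in_setU1 inE.
  by case/orP=> ->; rewrite ?orbT.
Qed.

Lemma glang_atom S : glang (atom S) [::] S.
Proof.
suff: forall s : seq Omega, {subset s <= S} -> glang (gens s) [::] S.
  by apply=> o; rewrite mem_enum.
elim=> //= o s IHs sS; exists [::], [::]; split=> //=.
  by split=> //; apply: sS; rewrite mem_head.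
by apply: IHs => p ps; apply: sS; rewrite in_cons ps orbT.
Qed.

Definition gstep (c : guard * Sigma) : regex letter :=
  atom c.1 * Letter (inl c.2).

Lemma gstep_le c : gstep c <== Letter (inl c.2).
Proof. by apply: kle_mul1l => //; exact: gens_le1. Qed.

End Tests.

(** * Deterministic automata on guarded strings *)

Section Automata.
Variables (Sigma Omega : finType).
Local Notation letter := (kapt_letter Sigma Omega).
Local Notation guard := {set Omega}.
Local Notation "e <== f" := (kle (@H_kapt Sigma Omega) e f) (at level 70).
Implicit Types (e f g : regex letter) (S T : guard).
Implicit Type (u v w : seq (guard * Sigma)).
Local Open Scope regex_scope.

Record dfa := Dfa {
  state :> finType;
  start : state;
  delta : state -> guard * Sigma -> state;
  final : state -> guard -> bool }.

Definition run (A : dfa) (q : A) u : A := foldl (@delta A) q u.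

(* That everything accepted from [start A] belongs to [glang e] need not be
   required: it follows from the first three fields by soundness. *)
Record represents (A : dfa) (e : regex letter) (R : A -> regex letter) : Prop := {
  repr_start : R (start A) <== e;
  repr_final : forall q S, final q S -> atom Sigma S <== R q;
  repr_delta : forall q c, gstep c * R (delta q c) <== R q;
  repr_run : forall u S, glang e u S -> final (run (start A) u) S }.

(** An atom can be duplicated and one copy charged to [R q]. This is how a run passes from one
    factor to the next without reading an action. *)
Lemma repr_atom (A : dfa) e R (q : A) S : represents e R -> final q S ->
  forall f x, atom Sigma S * f <== x -> atom Sigma S * f <== R q * x.
Proof.
move=> eR qS f x Sx; apply: kle_trans (kle_dotr _ (atom_idem _ _)) _.
by rewrite -ka_dotA; apply: kle_dot => //; exact: (repr_final eR qS).
Qed.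

Lemma repr_gstep (A : dfa) e R (q : A) c f x :
  represents e R -> final q c.1 ->
  gstep c * f <== x -> gstep c * f <== R q * x.
Proof.
rewrite /gstep -!ka_dotA => eR qc; exact: (repr_atom eR qc).
Qed.

Definition zero_dfa := @Dfa unit tt (fun _ _ => tt) (fun _ _ => false).

Lemma represents_zero : represents (A := zero_dfa) 0 (fun _ => 0).
Proof. by split=> //= q c; rewrite ka_dot0r. Qed.

(** In state [true] no action has been read; [false] is a sink. *)
Definition test_dfa (b : guard -> bool) :=
  @Dfa bool true (fun _ _ => false) (fun q S => q && b S).

Lemma represents_one :
  represents (A := test_dfa predT) 1 (fun q => if q then 1 else 0).
Proof.
split=> //=.
- by case=> //= S _; exact: gens_le1.
- by move=> q c; rewrite ka_dot0r; exact: kle_zero.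
- by move=> u S ->.
Qed.

Lemma represents_test (phi : tdl Omega) :
  represents (A := test_dfa (fun S => sat S phi)) (test Sigma phi)
    (fun q => if q then test Sigma phi else 0).
Proof.
split=> //=.
- by case=> //= S; exact: atom_sat.
- by move=> q c; rewrite ka_dot0r; exact: kle_zero.
- by move=> u S [-> ->].
Qed.

(** [None] means that nothing has been read, [Some true] that exactly [a] has; [Some false] is a
    sink. *)
Definition action_dfa (a : Sigma) := @Dfa (option bool) None
  (fun q c => Some ((q == None) && (c.2 == a)))
  (fun q _ => q == Some true).

Lemma represents_action a :
  represents (A := action_dfa a) (Letter (inl a))
    (fun q => if q is Some b then if b then 1 else 0 else Letter (inl a)).
Proof.
split=> //=.
- by case=> // -[] //= S _; exact: gens_le1.
- move=> q c; case: q => [b|] /=.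
    by rewrite ka_dot0r; exact: kle_zero.
  case: eqP => [<-|_]; last by rewrite ka_dot0r; exact: kle_zero.
  by rewrite ka_dot1r; exact: gstep_le.
- by move=> u S [T ->] /=; rewrite eqxx.
Qed.

Definition plus_dfa (A B : dfa) := @Dfa (A * B)%type (start A, start B)
  (fun q c => (delta q.1 c, delta q.2 c))
  (fun q S => final q.1 S || final q.2 S).

Lemma represents_plus (A B : dfa) e f R P :
  represents (A := A) e R -> represents (A := B) f P ->
  represents (A := plus_dfa A B) (e + f) (fun q => R q.1 + P q.2).
Proof.
move=> eR fP; split=> /=.
- by apply: kle_plus; [exact: (repr_start eR) | exact: (repr_start fP)].
- move=> q S /orP[qS|qS].
    by apply: kle_trans (kle_plusl _ _ _); exact: (repr_final eR qS).
  by apply: kle_trans (kle_plusr _ _ _); exact: (repr_final fP qS).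
- by move=> q c; rewrite ka_dotDr; apply: kle_plus;
    [exact: (repr_delta eR) | exact: (repr_delta fP)].
- move=> u S; have -> : run (A := plus_dfa A B) (start A, start B) u =
      (run (start A) u, run (start B) u).
    rewrite /run; by move: (start A) (start B); elim: u => [|c u IHu] p q //=.
  by case=> [/(repr_run eR)->|/(repr_run fP)->] //; rewrite orbT.
Qed.

(* The second component holds the states of the copies of [B] that have
   already read at least one action. *)
Definition dot_dfa (A B : dfa) := @Dfa (A * {set B})%type (start A, set0)
  (fun q c => (delta q.1 c, [set delta p c | p in
     if final q.1 c.1 then start B |: q.2 else q.2]))
  (fun q S => final q.1 S && final (start B) S || [exists p in q.2, final p S]).

Lemma represents_dot (A B : dfa) e f R P :
  represents (A := A) e R -> represents (A := B) f P ->
  represents (A := dot_dfa A B) (e * f)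
    (fun q => R q.1 * f + csum P (enum q.2)).
Proof.
move=> eR fP; split=> /=.
- rewrite enum_set0 /= ka_plus0; apply: kle_dotr; exact: (repr_start eR).
- move=> q S /orP[/andP[qS fS]|/exists_inP[p pq pS]].
    apply: kle_trans (kle_plusl _ _ _); rewrite -(ka_dot1r _ (atom _ _)).
    apply: (repr_atom eR qS); rewrite ka_dot1r.
    by apply: (kle_trans _ (repr_start fP)); exact: (repr_final fP fS).
  apply: kle_trans (kle_plusr _ _ _); apply: kle_trans (repr_final fP pS) _.
  by apply: csum_ub; rewrite mem_enum.
- move=> q c; apply: kle_lubdot.
    apply: kle_trans (kle_plusl _ _ _); rewrite ka_dotA; apply: kle_dotr.
    exact: (repr_delta eR).
  apply: dot_csum_lub => _ /[!mem_enum] /imsetP[p pq ->].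
  have p2 : p \in q.2 ->
      gstep c * P (delta p c) <== R q.1 * f + csum P (enum q.2).
    move=> pq2; apply: kle_trans (kle_plusr _ _ _).
    apply: kle_trans (repr_delta fP p c) _.
    by apply: csum_ub; rewrite mem_enum.
  (* For the copy launched by [c], the guard [c.1] is duplicated: it ends the part from [e] and
     starts the part from [f]. *)
  move: pq; case: ifP => [qc|_] // /setU1P[->|] //.
  apply: kle_trans (kle_plusl _ _ _); apply: (repr_gstep eR qc).
  by apply: (kle_trans _ (repr_start fP)); exact: (repr_delta fP).
- have later (p : B) (q : dot_dfa A B) u S : p \in q.2 -> final (run p u) S ->
      final (run (A := dot_dfa A B) q u) S.
    elim: u p q => [|c u IHu] p q pq pS /=.
      by apply/orP; right; apply/exists_inP; exists p.
    apply: IHu pS; apply: imset_f.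
    by case: ifP => // _; rewrite in_setU1 pq orbT.
  move=> _ S [v [w [-> /(repr_run eR) ev /(repr_run fP) fw]]].
  rewrite -/(run _ _); move: (start A) set0 ev => q Z.
  elim: v q Z => [|c v IHv] q Z /= ev; last exact: IHv.
  (* The first factor is exhausted: if [w] is empty both automata accept the last guard, otherwise
     its first action launches a copy of [B]. *)
  case: w ev fw => [|c w] /= ev fw; first by rewrite ev fw.
  by apply: later fw; apply: imset_f; rewrite ev setU11.
Qed.

Section StarDfa.
Variable A : dfa.

(* The boolean records that nothing has been read yet. *)
Definition restart (q : bool * {set A}) S :=
  q.1 || [exists p in q.2, final p S].

Definition star_dfa := @Dfa (bool * {set A})%type (true, set0)
  (fun q c => (false, [set delta p c | p in
     if restart q c.1 then start A |: q.2 else q.2]))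
  restart.

Lemma represents_star e R : represents (A := A) e R ->
  represents (A := star_dfa) (Star e)
    (fun q => (if q.1 then Star e else 0) + csum R (enum q.2) * Star e).
Proof.
move=> eR; split=> /=.
- by rewrite enum_set0 /= ka_dot0l ka_plus0.
- move=> [[] Z] S /= ; rewrite /restart /=.
    move=> _; apply: kle_trans (kle_plusl _ _ _).
    exact: kle_trans (gens_le1 _ _) (kle_star1 _ _).
  move=> /exists_inP[p pZ pS]; apply: kle_trans (kle_plusr _ _ _).
  apply: kle_1mulr; first exact: kle_star1.
  apply: kle_trans (repr_final eR pS) _.
  by apply: csum_ub; rewrite mem_enum.
- move=> [b Z] c /=; apply: kle_lubdot.
    by rewrite ka_dot0r; exact: kle_zero.
  rewrite ka_dotA.
  suff leR p : p \in (if restart (b, Z) c.1 then start A |: Z else Z) ->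
      gstep c * R (delta p c) * Star e <==
      (if b then Star e else 0) + csum R (enum Z) * Star e.
    set y := _ + _ in leR *.
    have: forall p : A, p \in enum [set delta p c | p in
        (if restart (b, Z) c.1 then start A |: Z else Z)] ->
        gstep c * (R p * Star e) <== y.
      move=> _ /[!mem_enum] /imsetP[p pq ->]; rewrite ka_dotA; exact: leR.
    elim: (enum [set _ | _ in _]) => [|p s IHs] ley /=.
      by rewrite ka_dot0r ka_dot0l; exact: kle_zero.
    rewrite -ka_dotA; apply: kle_trans (kle_dotl _ (ka_kle (ka_dotDl _ _ _ _))) _.
    apply: kle_lubdot; first by apply: ley; rewrite mem_head.
    by rewrite ka_dotA; apply: IHs => r rs; apply: ley; rewrite in_cons rs orbT.
  have leZ : p \in Z -> gstep c * R (delta p c) * Star e <==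
      (if b then Star e else 0) + csum R (enum Z) * Star e.
    move=> pZ; apply: kle_trans (kle_plusr _ _ _); apply: kle_dotr.
    apply: kle_trans (repr_delta eR p c) _.
    by apply: csum_ub; rewrite mem_enum.
  case: ifP => [rc|_] // /setU1P[->|] // {p leZ}.
  have les : gstep c * R (delta (start A) c) <== e.
    exact: kle_trans (repr_delta eR _ c) (repr_start eR).
  (* A new iteration starts either because nothing has been read, or because a running copy [p]
     accepts [c.1], which is then duplicated. *)
  case/orP: rc => /= [->|/exists_inP[p pZ pc]].
    apply: kle_trans (kle_plusl _ _ _); apply: kle_trans (kle_starS _ _).
    exact: kle_dotr.
  apply: kle_trans (kle_plusr _ _ _).
  apply: kle_trans (kle_dotr _ (repr_gstep eR pc les)) _.
  rewrite -ka_dotA; apply: kle_dot; last exact: kle_starS.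
  by apply: csum_ub; rewrite mem_enum.
- have step (p : A) (q : star_dfa) c : p \in q.2 ->
      delta p c \in (@delta star_dfa q c).2.
    by move=> pq; apply: imset_f; case: ifP => // _; rewrite in_setU1 pq orbT.
  have later (p : A) (q : star_dfa) u S : p \in q.2 -> final (run p u) S ->
      restart (run (A := star_dfa) q u) S.
    elim: u p q => [|c u IHu] p q pq pS /=.
      by apply/orP; right; apply/exists_inP; exists p.
    by apply: IHu pS; exact: step.
  move=> u S eu; rewrite -/(run _ _).
  (* Invariant along the iterations: the current state allows a restart at the guard where the
     remaining string begins. *)
  have : restart (true, set0) (hd u S) by [].
  elim: eu (true, set0) => [//|{}u v {}S /(repr_run eR) + _ IH] q.
  case: u => [|c u] /= eu rq; first exact: IH.
  rewrite /run foldl_cat; apply: (IH (run (A := star_dfa) _ u)).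
  by apply: later eu; apply: imset_f; rewrite rq setU11.
Qed.

End StarDfa.

(** A structurally computable bound. The powers of 2 come from the subset constructions, and [3] is
    the size of [action_dfa], the largest of the base automata. *)
Fixpoint nstates (e : regex letter) : nat :=
  match e with
  | Plus e f => nstates e * nstates f
  | Dot e f => nstates e * 2 ^ nstates f
  | Star e => 2 * 2 ^ nstates e
  | _ => 3
  end.

Lemma represents_exists e : exists (A : dfa) (R : A -> regex letter),
  represents e R /\ #|A| <= nstates e.
Proof.
have card_set (T : finType) m : #|T| <= m -> #|{set T}| <= 2 ^ m.
  by move=> Tm; rewrite -cardsT -powersetT card_powerset cardsT leq_pexp2l.
elim: e => [e [A [R [eR cA]]] f [B [P [fP cB]]]
           |e [A [R [eR cA]]] f [B [P [fP cB]]]|e [A [R [eR cA]]]|||[a|phi]].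
- exists (plus_dfa A B); eexists; split; first exact: represents_plus eR fP.
  by rewrite card_prod leq_mul.
- exists (dot_dfa A B); eexists; split; first exact: represents_dot eR fP.
  by rewrite card_prod leq_mul // card_set.
- exists (star_dfa A); eexists; split; first exact: represents_star eR.
  by rewrite card_prod card_bool leq_mul // card_set.
- exists zero_dfa; eexists; split; first exact: represents_zero.
  by rewrite card_unit.
- exists (test_dfa predT); eexists; split; first exact: represents_one.
  by rewrite card_bool.
- exists (action_dfa a); eexists; split; first exact: represents_action.
  by rewrite card_option card_bool.
- exists (test_dfa (fun S => sat S phi)); eexists; split.
    exact: represents_test.
  by rewrite card_bool.
Qed.

(** For the converse, soundness applied to [repr_final], then to [repr_delta] along the string, puts
    it in the language of [R (start A)]. *)
Lemma represents_glang (A : dfa) e (R : A -> regex letter) u S :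
  represents e R -> glang e u S <-> final (run (start A) u) S.
Proof.
move=> eR; split; first exact: (repr_run eR).
suff: final (run (start A) u) S -> glang (R (start A)) u S.
  by move=> h /h; exact: (kle_glang (repr_start eR)).
elim: u (start A) => [|c u IHu] q /= qS.
  apply: (kle_glang (repr_final eR qS)).
  exact: glang_atom.
apply: (kle_glang (repr_delta eR q c)); exists [:: c], u; split=> //=.
  by exists [::], [:: c]; split;
    [ | exact: glang_atom | exists c.1; case: c {qS}].
exact: IHu.
Qed.

End Automata.

(** * Completeness and reduction *)

Section TransitionMonoid.
Variables (Sigma Omega : finType) (Q : finType).
Variable d : Q -> {set Omega} * Sigma -> Q.
Local Notation letter := (kapt_letter Sigma Omega).
Local Notation guard := {set Omega}.
Local Notation "e <== f" := (kle (@H_kapt Sigma Omega) e f) (at level 70).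
Local Open Scope regex_scope.

Local Notation N := {ffun Q -> Q}.
Implicit Types s t r : N.

Definition tid : N := [ffun q => q].
Definition tcomp s t : N := [ffun q => t (s q)].
Definition tstep s c : N := [ffun q => d (s q) c].

Lemma tcomp1s s : tcomp tid s = s.
Proof. by apply/ffunP=> q; rewrite !ffunE. Qed.

Lemma tcomps1 s : tcomp s tid = s.
Proof. by apply/ffunP=> q; rewrite !ffunE. Qed.

Lemma tcompA s t r : tcomp s (tcomp t r) = tcomp (tcomp s t) r.
Proof. by apply/ffunP=> q; rewrite !ffunE. Qed.

Lemma tcomp_step s t c : tcomp s (tstep t c) = tstep (tcomp s t) c.
Proof. by apply/ffunP=> q; rewrite !ffunE. Qed.

Lemma tstepE s c : tstep s c = tcomp s (tstep tid c).
Proof. by rewrite tcomp_step tcomps1. Qed.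

Lemma foldl_tstep s u : foldl tstep s u = tcomp s (foldl tstep tid u).
Proof.
elim/last_ind: u => [|u c IHu]; first by rewrite tcomps1.
by rewrite -!cats1 !foldl_cat /= IHu tcomp_step.
Qed.

Lemma tstep_run u q : foldl tstep tid u q = foldl d q u.
Proof.
elim/last_ind: u => [|u c IHu]; first by rewrite ffunE.
by rewrite -!cats1 !foldl_cat /= ffunE IHu.
Qed.

(** Adjacency matrix of the Cayley graph: reading [c] multiplies the current transformation on the
    right. *)
Definition tmatrix s t : regex letter :=
  csum (@gstep Sigma Omega) [seq c <- enum predT | tstep s c == t].

(* The regular expression of all words inducing the transformation [s]. *)
Definition tword s := mstar tmatrix tid s.

Lemma tmatrix_step s c : gstep c <== tmatrix s (tstep s c).
Proof.
have := @csum_ub _ (@H_kapt Sigma Omega) _ (@gstep Sigma Omega); apply.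
by rewrite mem_filter eqxx mem_enum.
Qed.

Lemma tword_step s c : tword s * gstep c <== tword (tstep s c).
Proof.
apply: kle_trans (mstar_cat _ _ _ s _); apply: kle_dotl.
apply: kle_trans (mstar_incl _ _ _ _); exact: tmatrix_step.
Qed.

Lemma gstep_tword c : gstep c <== tword (tstep tid c).
Proof. apply: kle_trans (mstar_incl _ _ _ _); exact: tmatrix_step. Qed.

(** Left composition with [s] commutes with steps, so [r] mapped to [tword (tcomp s r)] is stable
    under [tmatrix] and [mstar_row] applies. *)
Lemma tword_cat s t : tword s * tword t <== tword (tcomp s t).
Proof.
pose y r := tword (tcomp s r).
suff Hy r r' : y r * tmatrix r r' <== y r'.
  by have := mstar_row Hy tid t; rewrite /y tcomps1.
apply: dot_csum_lub => c; rewrite mem_filter => /andP[/eqP <- _].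
by rewrite /y tcomp_step; exact: tword_step.
Qed.

(** Evaluation at [q] maps the Cayley graph to the automaton, so [x] pulls back to a family stable
    under [tmatrix]. *)
Lemma tword_col (x : Q -> regex letter) s q :
  (forall p c, gstep c * x (d p c) <== x p) -> tword s * x (s q) <== x q.
Proof.
move=> dx; pose y (r : N) := x (r q).
suff Hy r r' : tmatrix r r' * y r' <== y r 
  by have := mstar_col Hy tid s; rewrite /y [tid q]ffunE.
apply: csum_dot_lub => c; rewrite mem_filter => /andP[/eqP <- _].
by rewrite /y ffunE.
Qed.

End TransitionMonoid.

(** * Completeness for guarded strings and for the closure *)

Section Completeness.
Variables Sigma Omega : finType.
Local Notation letter := (kapt_letter Sigma Omega).
Local Notation guard := {set Omega}.
Local Notation "e <== f" := (kle (@H_kapt Sigma Omega) e f) (at level 70).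
Implicit Types (e f g : regex letter) (S T U : guard).
Local Open Scope regex_scope.

(* The star case bounds [Star e] by the finitely many expressions [tword s] of
   the transition monoid of [d]; a bound in terms of [x] alone would require
   meets of the [x q]. *)
Lemma glang_lub e (Q : finType) (d : Q -> guard * Sigma -> Q)
    (x : Q -> regex letter) g q S :
  (forall p c, gstep c * x (d p c) <== x p) ->
  (forall u T, S \subset hd u T -> glang e u T ->
     atom Sigma T * g <== x (foldl d q u)) ->
  atom Sigma S * e * g <== x q.
Proof.
elim: e Q d x g q S
  => [e IHe f IHf|e IHe f IHf|e IHe|||[a|phi]] Q d x g q S dx.
- move=> ex; rewrite ka_dotDr; apply: kle_dotlub.
    by apply: (IHe _ _ _ _ _ _ dx) => u T ST eu; apply: ex => //; left.
  by apply: (IHf _ _ _ _ _ _ dx) => u T ST eu; apply: ex => //; right.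
- move=> ex; apply: (@kle_trans _ _ (atom Sigma S * e * (f * g))).
    by rewrite !ka_dotA.
  apply: (IHe _ _ _ _ _ _ dx) => v T ST ev; rewrite ka_dotA.
  apply: (IHf _ _ _ _ _ _ dx) => w U TU fw; rewrite -foldl_cat.
  apply: ex; first by rewrite hd_cat; apply: subset_trans ST (hd_sub _ TU).
  by exists v, w; split=> //; exact: glangS TU ev.
- move=> ex.
  (* The pairs of transformation and last guard realised by strings of [Star e] whose first guard
     contains [S]. *)
  pose acc s T := exists u, [/\ S \subset hd u T, gstar (glang e) u T &
    foldl (tstep d) (tid Q) u = s].
  (* [Z r] sums the continuations of [r] to a pair in [acc], a residual of [Star e]. The sum is
     finite; membership in [acc] is decided classically. *)
  pose Z r := csum (fun sT => tword d sT.1 * atom Sigma sT.2)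
    [seq sT : {ffun Q -> Q} * guard <- enum predT |
      `[< acc (tcomp r sT.1) sT.2 >]].
  have Z_ub r s T : acc (tcomp r s) T -> tword d s * atom Sigma T <== Z r.
    move=> sT; pose F := fun sT : {ffun Q -> Q} * guard =>
      tword d sT.1 * atom Sigma sT.2.
    have := @csum_ub _ (@H_kapt Sigma Omega) _ F; move/(_ _ (s, T)); apply.
    by rewrite mem_filter mem_enum andbT; exact/asboolP.
  have Z_ub1 r T : acc r T -> atom Sigma T <== Z r.
    move=> rT; apply: kle_trans (Z_ub r (tid Q) T _); last by rewrite tcomps1.
    by apply: kle_1mull => //; exact: mstar1.
  have Z_step r c : gstep c * Z (tstep d r c) <== Z r.
    apply: dot_csum_lub => -[s T] /=.
    rewrite mem_filter => /andP[/asboolP/= sT _].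
    apply: kle_trans (Z_ub r (tcomp (tstep d (tid Q) c) s) T _).
      rewrite ka_dotA; apply: kle_dotr; apply: kle_trans (tword_cat _ _ _).
      by apply: kle_dotr; exact: gstep_tword.
    by rewrite tcompA -tstepE.
  have Z_cat s : tword d s * Z s <== Z (tid Q).
    apply: dot_csum_lub => -[t T] /=.
    rewrite mem_filter => /andP[/asboolP/= tT _].
    apply: kle_trans (Z_ub _ (tcomp s t) T _); last by rewrite tcomp1s.
    by rewrite ka_dotA; apply: kle_dotr; exact: tword_cat.
  (* Right star induction. Each summand of [Z (tid Q)] multiplied by [e] is bounded by the induction
     hypothesis for [e], over the automaton of transformations and its solution [Z]. *)
  have: atom Sigma S * Star e <== Z (tid Q).
    apply: kle_star_indr.
      by apply: Z_ub1; exists [::]; split=> //; exact: gstar_nil.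
    apply: csum_dot_lub => -[s T] /=; rewrite mem_filter => /andP[/asboolP/=].
    rewrite tcomp1s => -[v [Sv ev vs]] _; apply: kle_trans (Z_cat s).
    rewrite -ka_dotA; apply: kle_dotl; rewrite -(ka_dot1r _ (_ * e)).
    rewrite -[s in Z s]tcomps1.
    apply: (IHe _ (tstep d) (fun t => Z (tcomp s t))) => [t c|u U TU eu].
      by rewrite tcomp_step; exact: Z_step.
    rewrite ka_dot1r; apply: Z_ub1; exists (v ++ u); split.
    - by rewrite hd_cat; apply: subset_trans Sv (hd_sub _ TU).
    - apply: gstar_cat; first exact: (@glangS _ _ (Star e) _ _ _ TU ev).
      by rewrite -[u]cats0; apply: gstar_app; last exact: gstar_nil.
    - by rewrite foldl_cat vs foldl_tstep.
  (* Back to [x]: each summand stems from an actual string [u] inducing [s], to which [ex]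
     applies. *)
  move=> /kle_dotr /kle_trans; apply; apply: csum_dot_lub => -[s T] /=.
  rewrite mem_filter => /andP[/asboolP/=]; rewrite tcomp1s => -[u [Su eu us]] _.
  rewrite -ka_dotA; apply: kle_trans (tword_col s q dx); apply: kle_dotl.
  by rewrite -us tstep_run; exact: ex.
- by rewrite ka_dot0r ka_dot0l => _; exact: kle_zero.
- by rewrite ka_dot1r => /(_ [::] S); apply.
(* The guard after the action is unconstrained, so the least one, [set0], is taken; its atom is
   [1]. *)
- move=> ex; apply: kle_trans (dx q (S, a)); apply: kle_dotl.
  apply: kle_trans (ex [:: (S, a)] set0 _ _) => //; last by exists S.
  by apply: kle_1mull => //; exact: atom0.
- move=> ex; apply: atom_test_lub => T ST Tphi.
  by apply: (ex [::]).
Qed.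

(** [glang_lub] is applied to the expressions of the automaton of [f], with [atom set0], that is
    [1], in front of [e] and [1] behind it. *)
Lemma glang_sub_kle e f :
  (forall u S, glang e u S -> glang f u S) -> e <== f.
Proof.
move=> ef; have [A [R [fR _]]] := represents_exists f.
apply: (kle_trans _ (repr_start fR)).
apply: (@kle_trans _ _ (atom Sigma set0 * e * 1)).
  by rewrite ka_dot1r; apply: kle_1mull => //; exact: atom0.
apply: (glang_lub (repr_delta fR)) => u T _ /ef /(repr_run fR) uT.
by rewrite ka_dot1r; exact: (repr_final fR uT).
Qed.

Lemma kaP e f : ka (@H_kapt Sigma Omega) e f <->
  forall u S, glang e u S <-> glang f u S.
Proof.
split; first exact: ka_glang.
by move=> ef; apply: kle_antisym; apply: glang_sub_kle => u S /ef.
Qed.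

(** A guarded string of [e] comes from a word of [e]; this word is in the closure of [lang f], so
    its guarded strings are in [glang f]. *)
Lemma kapt_complete : ka_complete (@H_kapt Sigma Omega).
Proof.
have half e f : (forall w, hclosure (@H_kapt Sigma Omega) (lang e) w ->
    hclosure (@H_kapt Sigma Omega) (lang f) w) -> e <== f.
  move=> ef; apply: glang_sub_kle => u S /glangP[w ew wu].
  by apply: hclosure_gword wu; apply: ef; exact: hclosure_incl.
by move=> e f ef; apply: kle_antisym; apply: half => w /ef.
Qed.

End Completeness.

(** * Normal forms over actions and generators *)

Section Reduction.
Variables Sigma Omega : finType.
Local Notation letter := (kapt_letter Sigma Omega).
Local Notation guard := {set Omega}.
Local Notation "e <== f" := (kle (@H_kapt Sigma Omega) e f) (at level 70).
Implicit Types (e f : regex letter) (S T U : guard).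
Local Open Scope regex_scope.

Local Notation prim := (Sigma + Omega)%type.

Definition emb (c : prim) : letter :=
  match c with inl a => inl a | inr o => inr (Gen o) end.

Local Notation embr := (map_regex emb).

Definition any_gen : regex prim := csum (fun o => Letter (inr o)) (enum Omega).

Definition any_gens : regex prim := Star any_gen.

(** The words over the generators having [s] as a scattered subword. *)
Definition superword (s : seq Omega) : regex prim :=
  foldr (fun o r => any_gens * (Letter (inr o) * r)) any_gens s.

(** Derivably equal to [atom S], but its plain language already holds all words over the generators
    in which each element of [S] occurs, in any order and with repetitions. No closure is then
    needed. *)
Definition cover S : regex prim := csum superword (permutations (enum S)).

Lemma any_gens_le1 : embr any_gens <== 1.
Proof.
apply: (@kle_star_one _ _ (embr any_gen)).
rewrite map_csum; apply: csum_lub => o _.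
exact: test_le1.
Qed.

Lemma cover_atom S : embr (cover S) <== atom Sigma S.
Proof.
rewrite map_csum; apply: csum_lub => s; rewrite mem_permutations => sS.
apply: (@kle_trans _ _ (gens Sigma s)); last first.
  by apply: gens_sub => o; rewrite (perm_mem sS).
elim: s {sS} => [|o s IHs] /=; first exact: any_gens_le1.
by apply: kle_mul1l; [exact: any_gens_le1 | exact: kle_dotl].
Qed.

Lemma atom_cover S : atom Sigma S <== embr (cover S).
Proof.
rewrite map_csum.
apply: (@kle_trans _ _ (embr (superword (enum S)))); last first.
  have := @csum_ub _ (@H_kapt Sigma Omega) _ (embr \o superword); apply.
  by rewrite mem_permutations.
rewrite /atom; elim: (enum S) => [|o s IHs] /=; first exact: kle_star1.
by apply: kle_1mull; [exact: kle_star1 | exact: kle_dotl].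
Qed.

Lemma lang_csum (X : Type) (I : eqType) (F : I -> regex X) s i w :
  i \in s -> lang (F i) w -> lang (csum F s) w.
Proof. by move=> /(csum_ub (@no_hyps X) F) Fi; exact: kle_lang. Qed.

Lemma any_gen_lang o : lang any_gen [:: inr o].
Proof.
by apply: (lang_csum (F := fun o => Letter (inr o)) (i := o)); rewrite ?mem_enum.
Qed.

Lemma any_gens_lang s : lang any_gens (map inr s).
Proof.
elim: s => [|o s IHs]; first exact: star_nil.
exact: (star_app (any_gen_lang o) IHs).
Qed.

Lemma superword_lang s t : subseq s t -> lang (superword s) (map inr t).
Proof.
elim: t s => [|o t IHt] [|p s] //=.
- by move=> _; exact: star_nil.
- by move=> _; exact: (any_gens_lang (o :: t)).
case: eqP => [->|_] st.
  exists [::], (map inr (o :: t)); split=> //; first exact: star_nil.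
  by exists [:: inr o], (map inr t); split=> //; exact: IHt.
have [u [v [tE ux vy]]] := IHt _ st; exists (inr o :: u), v; split=> //.
  by rewrite /= -tE.
exact: (star_app (any_gen_lang o) ux).
Qed.

Lemma cover_lang (s : seq Omega) : lang (cover [set o in s]) (map inr s).
Proof.
(* [undup s] is a permutation of the set of letters of [s] and a subsequence of [s]. *)
apply: (lang_csum (F := superword) (i := undup s)).
  rewrite mem_permutations uniq_perm ?undup_uniq ?enum_uniq // => o.
  by rewrite mem_undup mem_enum inE.
exact/superword_lang/undup_subseq.
Qed.

Section Solution.
Variable A : dfa Sigma Omega.

Definition cstep (c : guard * Sigma) : regex prim :=
  cover c.1 * Letter (inl c.2).

Definition ctrans (q p : A) : regex prim :=
  csum cstep [seq c <- enum predT | delta q c == p].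

(** Matrix star times the vector of final guards, with covers in place of atoms. *)
Definition solution (q : A) : regex prim :=
  csum (fun pS => mstar ctrans q pS.1 * cover pS.2)
    [seq pS : A * guard <- enum predT | final pS.1 pS.2].

Lemma solution_step q c :
  kle (@no_hyps prim) (cstep c * solution (delta q c)) (solution q).
Proof.
apply: dot_csum_lub => pS pSf; rewrite ka_dotA.
apply: (@kle_trans _ _ (mstar ctrans q pS.1 * cover pS.2)); last first.
  pose F (pS : A * guard) := mstar ctrans q pS.1 * cover pS.2.
  exact: (csum_ub _ F pSf).
apply: kle_dotr; apply: kle_trans (mstar_cat _ _ _ (delta q c) _).
apply: kle_dotr; apply: kle_trans (mstar_incl _ _ _ _).
have := @csum_ub _ (@no_hyps prim) _ cstep; apply.
by rewrite mem_filter eqxx mem_enum.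
Qed.

Lemma solution_final q S : final q S ->
  kle (@no_hyps prim) (cover S) (solution q).
Proof.
move=> qS; pose F (pS : A * guard) := mstar ctrans q pS.1 * cover pS.2.
apply: (@kle_trans _ _ (F (q, S))).
  by apply: kle_1mull => //; exact: mstar1.
by apply: (csum_ub _ F); rewrite mem_filter qS mem_enum.
Qed.

Lemma solution_least (x : A -> regex letter) :
  (forall q S, final q S -> atom Sigma S <== x q) ->
  (forall q c, gstep c * x (delta q c) <== x q) ->
  forall q, embr (solution q) <== x q.
Proof.
move=> xf xd q; rewrite map_csum; apply: csum_lub => -[p S].
rewrite mem_filter => /andP[pS _].
change (embr (mstar ctrans q p) * embr (cover S) <== x q); rewrite map_mstar.
apply: (@kle_trans _ _ (mstar (fun q p => embr (ctrans q p)) q p * x p)).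
  apply: kle_dotl; apply: kle_trans (xf _ _ pS); exact: cover_atom.
apply: (mstar_col (x := x)) => {q S pS}q {}p.
rewrite map_csum; apply: csum_dot_lub => c.
rewrite mem_filter => /andP[/eqP <- _].
apply: kle_trans (xd q c); apply: kle_dotr; apply: kle_dotr; exact: cover_atom.
Qed.

(** A word cut into blocks of generators, each closed by an action except the last block [s]. *)
Definition flat (l : seq (seq Omega * Sigma)) (s : seq Omega) : seq prim :=
  flatten [seq rcons (map inr b.1) (inl b.2) | b <- l] ++ map inr s.

Lemma flatP w : exists l s, w = flat l s.
Proof.
elim: w => [|[a|o] w [l [s ->]]]; first by exists [::], [::].
  by exists (([::], a) :: l), s.
case: l => [|[t a] l]; first by exists [::], (o :: s).
by exists ((o :: t, a) :: l), s.
Qed.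

(** Each block is read with the least guard satisfying all its generators. *)
Definition guards (l : seq (seq Omega * Sigma)) : seq (guard * Sigma) :=
  [seq ([set o in b.1], b.2) | b <- l].

Lemma gword_gens (s : seq Omega) S : {subset s <= S} ->
  gword (map emb (map inr s)) [::] S.
Proof.
elim: s => //= o s IHs sS; exists [::], [::]; split=> //=.
  by split=> //; apply: sS; rewrite mem_head.
by apply: IHs => p ps; apply: sS; rewrite in_cons ps orbT.
Qed.

Lemma gword_flat l s : gword (map emb (flat l s)) (guards l) [set o in s].
Proof.
elim: l => [|[t a] l IHl].
  by apply: gword_gens => o; rewrite inE.
rewrite /flat /= -catA map_cat -cats1 map_cat -catA; apply/gword_cat.
exists [::], (guards ((t, a) :: l)); split=> //=.
  by apply: gword_gens => o; rewrite inE.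
exists [:: ([set o in t], a)], (guards l); split=> //.
by exists [set o in t].
Qed.

Lemma solution_flat l s q : final (run q (guards l)) [set o in s] ->
  lang (solution q) (flat l s).
Proof.
elim: l q => [|[t a] l IHl] q /= qs.
  by apply: kle_lang (solution_final qs) _; exact: cover_lang.
apply: kle_lang (solution_step q ([set o in t], a)) _.
exists (rcons (map inr t) (inl a)), (flat l s); split.
- by rewrite /flat /= -catA.
- by exists (map inr t), [:: inl a]; rewrite cats1; split=> //; exact: cover_lang.
- exact: IHl.
Qed.

End Solution.

(** [solution_least] bounds the solution by [e], and [glang_lub] bounds [e] by the solution. For a
    word of the closure, the automaton accepts its string of least guards, so the solution generates
    the word itself. *)
Lemma normal_form_exists e : exists r : regex prim,
  ka (@H_kapt Sigma Omega) e (embr r) /\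
  forall w, hclosure (@H_kapt Sigma Omega) (lang e) (map emb w) -> lang r w.
Proof.
have [A [R [eR _]]] := represents_exists e.
exists (solution (start A)); split; last first.
  move=> w; have [l [s ->]] := flatP w => /hclosure_gword.
  by move=> /(_ _ _ (gword_flat l s)) /(repr_run eR); exact: solution_flat.
have no_embr (f g : regex prim) :
      kle (@no_hyps prim) f g -> embr f <== embr g.
  exact: ka_map.
apply: kle_antisym; last first.
  apply: (kle_trans _ (repr_start eR)).
  by apply: solution_least; [exact: (repr_final eR) | exact: (repr_delta eR)].
apply: (@kle_trans _ _ (atom Sigma set0 * e * 1)).
  by rewrite ka_dot1r; apply: kle_1mull => //; exact: atom0.
apply: (@glang_lub _ _ _ _ (@delta _ _ A) (fun q => embr (solution q))).
  move=> q c; apply: (kle_trans _ (no_embr _ _ (solution_step q c))).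
  by apply: kle_dotr; apply: kle_dotr; exact: atom_cover.
move=> u T _ /(repr_run eR) /solution_final /no_embr uT.
by rewrite ka_dot1r; apply: kle_trans uT; exact: atom_cover.
Qed.

(** The sub-alphabet of the reduction; being Boolean, it has unique proofs, so [sig is_prim] is in
    bijection with [prim]. *)
Definition is_prim (x : letter) : bool :=
  match x with inr (Join _ _) | inr (Meet _ _) => false | _ => true end.

Lemma emb_prim c : is_prim (emb c). Proof. by case: c. Qed.

Definition to_prim (c : prim) : sig is_prim := exist _ (emb c) (emb_prim c).

Lemma to_prim_surj x : exists c, to_prim c = x.
Proof.
have subE (c : prim) y p : emb c = y -> to_prim c = exist _ y p.
  by move=> cy; move: p; rewrite -cy => p;
    rewrite (bool_irrelevance p (emb_prim c)).
by case: x => -[a|[//|//|o]] p; [exists (inl a) | exists (inr o)]; exact: subE.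
Qed.

Lemma map_to_prim_surj w : exists v, map to_prim v = w.
Proof.
elim: w => [|x w [v <-]]; first by exists [::].
by have [c <-] := to_prim_surj x; exists (c :: v).
Qed.

Lemma lang_map (X Y : Type) (h : X -> Y) (e : regex X) w :
  lang e w -> lang (map_regex h e) (map h w).
Proof.
elim: e w => [e IHe f IHf|e IHe f IHf|e IHe|||x] w //=.
- by move=> [/IHe|/IHf]; [left|right].
- move=> [u [v [-> /IHe eu /IHf fv]]]; exists (map h u), (map h v).
  by rewrite map_cat.
- elim=> [|u v /IHe eu _ IH]; first exact: star_nil.
  by rewrite map_cat; exact: star_app.
- by move=> ->.
- by move=> ->.
Qed.

Lemma map_regex_comp (X Y Z : Type) (h : Y -> Z) (k : X -> Y) (e : regex X) :
  map_regex h (map_regex k e) = map_regex (h \o k) e.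
Proof. by elim: e => //= [e -> f ->|e -> f ->|e ->]. Qed.

Lemma kapt_reduces : reduces_to_empty (@H_kapt Sigma Omega).
Proof.
exists is_prim; split=> //=.
have [r rP] := choice normal_form_exists.
exists (fun e => map_regex to_prim (r e)) => e; have [er re] := rP e; split.
  by rewrite map_regex_comp.
move=> w; have [v <-] := map_to_prim_surj w; rewrite -map_comp => ev.
by apply: hclosure_incl; apply: lang_map; exact: re.
Qed.

End Reduction.

(** * Comparison of derivatives *)

Section Decision.
Variables Sigma Omega : finType.
Local Notation letter := (kapt_letter Sigma Omega).
Local Notation guard := {set Omega}.
Implicit Types (e f : regex letter) (S : guard) (c : guard * Sigma).
Implicit Type (u : seq (guard * Sigma)).

Fixpoint nullable S e : bool :=
  match e with
  | Plus e f => nullable S e || nullable S f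
  | Dot e f => nullable S e && nullable S f
  | Star _ => true
  | Zero => false
  | One => true
  | Letter (inl _) => false
  | Letter (inr phi) => sat S phi
  end.

Fixpoint deriv c e : regex letter :=
  match e with
  | Plus e f => Plus (deriv c e) (deriv c f)
  | Dot e f =>
      Plus (Dot (deriv c e) f) (if nullable c.1 e then deriv c f else Zero)
  | Star e => Dot (deriv c e) (Star e)
  | Zero => Zero
  | One => Zero
  | Letter (inl a) => if a == c.2 then One else Zero
  | Letter (inr _) => Zero
  end.

Lemma glang_nullable e S : glang e [::] S <-> nullable S e.
Proof.
elim: e => [e IHe f IHf|e IHe f IHf|e IHe|||[a|phi]] /=.
- by rewrite IHe IHf; split=> [[->|->]|/orP]; rewrite ?orbT.
- split=> [[v [w [vw]]]|/andP[/IHe ee /IHf fe]]; last by exists [::], [::].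
  by case: v vw => //; case: w => //= _ /IHe-> /IHf->.
- by split=> // _; exact: gstar_nil.
- by [].
- by [].
- by split=> // -[].
- by split=> [[]|->].
Qed.

(** Leading factors without actions are dropped; the first factor with an action supplies
    [c :: v]. *)
Lemma gstar_cons (L : glanguage Sigma Omega) c u S : gstar L (c :: u) S ->
  exists v w, [/\ u = v ++ w, L (c :: v) (hd w S) & gstar L w S].
Proof.
move: {-2}(c :: u) (erefl (c :: u)) => t tE Lt.
elim: Lt c u tE => // -[|c' v] w {}S Lv Lw IH c u /=; first exact: IH.
by move=> [<- <-]; exists v, w.
Qed.

Lemma glang_deriv e c u S : glang (deriv c e) u S <-> glang e (c :: u) S.
Proof.
elim: e u S => [e IHe f IHf|e IHe f IHf|e IHe|||[a|phi]] u S /=.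
- by rewrite IHe IHf.
- split=> [[[v [w [-> /IHe ev fw]]]|]|[[|c' v] [w [/= tE ev fw]]]].
  + by exists (c :: v), w.
  + case: ifP => // /glang_nullable ce /IHf fu.
    by exists [::], (c :: u).
  + move: ev; rewrite -tE /= => /glang_nullable ->; right.
    by apply/IHf; rewrite tE.
  + by case: tE ev => <- -> ev; left; exists v, w; split=> //; apply/IHe.
- split=> [[v [w [-> /IHe ev ew]]]|]; first exact: (@gstar_app _ _ _ (c :: v)).
  move=> /gstar_cons[v [w [-> ev ew]]].
  by exists v, w; split=> //; apply/IHe.
- by [].
- by split.
- case: c => T b /=; case: eqP => [->|ab] /=; split=> //.
  + by move=> ->; exists T.
  + by move=> [T' []].
  + by move=> [T' [_ ba _]]; case: ab.
- by split=> // -[].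
Qed.

Fixpoint agree n e f : bool :=
  if n is n'.+1 then
    all (fun S => nullable S e == nullable S f) (enum {: guard}) &&
    all (fun c => agree n' (deriv c e) (deriv c f)) (enum {: guard * Sigma})
  else true.

Lemma agree_glang n e f :
  (forall u S, glang e u S <-> glang f u S) -> agree n e f.
Proof.
elim: n e f => //= n IHn e f ef; apply/andP; split; apply/allP.
  move=> S _; apply/eqP; apply/idP/idP => /glang_nullable /ef;
  by move/glang_nullable.
by move=> c _; apply: IHn => u S; rewrite !glang_deriv.
Qed.

Section Product.
Variables A B : dfa Sigma Omega.

(* [iter n disagree set0] is the set of pairs of states told apart by a guarded
   string with fewer than [n] actions. *)
Definition disagree (Z : {set A * B}) : {set A * B} :=
  [set p | [exists S, final p.1 S != final p.2 S] ||
           [exists c, (delta p.1 c, delta p.2 c) \in Z]].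

Lemma disagreeS : {homo disagree : Y Z / Y \subset Z}.
Proof.
move=> Y Z YZ; apply/subsetP=> p; rewrite !inE => /orP[->//|].
by move=> /existsP[c cY]; apply/orP; right; apply/existsP; exists c;
  exact: (subsetP YZ).
Qed.

Lemma iter_disagreeS m n : m <= n ->
  iter m disagree set0 \subset iter n disagree set0.
Proof.
move=> /subnK <-; elim: (n - m) => //= k /subset_trans; apply.
by elim: (k + m) => [|j IHj]; [exact: sub0set | exact: disagreeS].
Qed.

Lemma agree_iter n e f (p : A * B) :
  (forall u S, glang e u S <-> final (run p.1 u) S) ->
  (forall u S, glang f u S <-> final (run p.2 u) S) ->
  agree n e f -> p \notin iter n disagree set0.
Proof.
elim: n e f p => [|n IHn] e f p ep fp /=; first by rewrite inE.
move=> /andP[/allP nul /allP der]; rewrite inE negb_or !negb_exists.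
apply/andP; split; apply/forallP.
  move=> S; rewrite negbK; have /eqP ef := nul S (mem_enum _ S).
  have e1 : nullable S e = final p.1 S.
    by apply/idP/idP => [/glang_nullable/ep|/(ep [::])/glang_nullable].
  have e2 : nullable S f = final p.2 S.
    by apply/idP/idP => [/glang_nullable/fp|/(fp [::])/glang_nullable].
  by rewrite -e1 -e2 ef.
move=> c; apply: (IHn _ _ _ _ _ (der c (mem_enum _ c))) => u S;
  by rewrite glang_deriv ?ep ?fp.
Qed.

(** The increasing iteration of [disagree] is stationary after as many steps as there are pairs of
    states. The start pair thus avoids the fixed point, and so do all pairs reached from it. *)
Lemma agree_run n e f :
  (forall u S, glang e u S <-> final (run (start A) u) S) ->
  (forall u S, glang f u S <-> final (run (start B) u) S) ->
  #|{: A * B}| <= n -> agree n e f -> forall u S, glang e u S <-> glang f u S.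
Proof.
move=> eA fB /iter_disagreeS; set m := #|_| => mn ef.
pose p0 := (start A, start B).
have : p0 \notin iter n disagree set0 by exact: agree_iter ef.
(* [fixset] is by definition the iteration from [set0] repeated [m] times. *)
move=> /(contra (subsetP mn _)); rewrite -/(fixset disagree) => p0Z u S.
rewrite eA fB; apply: iff_sym.
suff /eqP-> : final (run p0.1 u) S == final (run p0.2 u) S by [].
elim: u p0 p0Z => [|c u IHu] p; rewrite -(fixsetK disagreeS) inE negb_or
  !negb_exists => /andP[/forallP nul /forallP der].
  by have := nul S; rewrite negbK.
exact: IHu (_, _) (der c).
Qed.

End Product.

Lemma agreeP e f :
  agree (nstates e * nstates f) e f <->
  forall u S, glang e u S <-> glang f u S.
Proof.
split; last exact: agree_glang.
have [A [R [eR cA]]] := represents_exists e.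
have [B [P [fP cB]]] := represents_exists f.
apply: (@agree_run A B) => [u S|u S|].
- exact: (represents_glang _ _ eR).
- exact: (represents_glang _ _ fP).
- by rewrite card_prod leq_mul.
Qed.

End Decision.

(** * Combinators *)

Lemma closed_at_le k l t : k <= l -> closed_at k t -> closed_at l t.
Proof.
elim: t k l => [n|t IHt u IHu|t IHt] k l kl /=.
- by move=> nk; exact: leq_trans kl.
- by move=> /andP[/(IHt _ _ kl)-> /(IHu _ _ kl)->].
- by apply: IHt; rewrite ltnS.
Qed.

Lemma subst_closed k u t : closed_at k t -> subst k u t = t.
Proof.
elim: t k u => [n|t IHt v IHv|t IHt] k u /=.
- by move=> ->.
- by move=> /andP[/IHt-> /IHv->].
- by move=> /IHt->.
Qed.

Lemma lift_closed k t : closed_at k t -> Defs.lift k t = t.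
Proof.
elim: t k => [n|t IHt v IHv|t IHt] k /=.
- by move=> ->.
- by move=> /andP[/IHt-> /IHv->].
- by move=> /IHt->.
Qed.

Lemma closed_iter_Lam k n t : closed_at k (iter n Lam t) = closed_at (n + k) t.
Proof. by elim: n k => //= n IHn k; rewrite IHn addnS. Qed.

Lemma subst_iter_Lam k n u t : closed_term u ->
  subst k u (iter n Lam t) = iter n Lam (subst (n + k) u t).
Proof.
move=> cu; elim: n k => //= n IHn k.
by rewrite lift_closed // IHn addnS.
Qed.

#[global] Instance beta_conv_equivalence : Equivalence beta_conv.
Proof.
split; first exact: rst_refl.
  by move=> t u; exact: rst_sym.
by move=> t u v; exact: rst_trans.
Qed.

#[global] Instance App_Proper :
  Proper (beta_conv ==> beta_conv ==> beta_conv) App.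
Proof.
move=> t t' tt' u u' uu'; transitivity (App t' u).
  elim: tt' => {t t'} [t t' b|t|t t' _|t1 t2 t3 _ IH1 _ IH2].
  - by apply: rst_step; exact: beta_appl.
  - reflexivity.
  - exact: symmetry.
  - exact: transitivity IH1 IH2.
elim: uu' => {u u'} [u u' b|u|u u' _|u1 u2 u3 _ IH1 _ IH2].
- by apply: rst_step; exact: beta_appr.
- reflexivity.
- exact: symmetry.
- exact: transitivity IH1 IH2.
Qed.

(** On closed terms substitution and lifting are trivial, so conversion reduces to rewriting in
    applications. *)
Record combinator := Combinator {
  cterm :> term;
  cterm_closed : closed_term cterm }.

HB.instance Definition _ := [isSub for cterm].

Lemma id_closed : closed_term (Lam (Var 0)). Proof. by []. Qed.

Definition cid := Combinator id_closed.

Definition cconv (a b : combinator) := beta_conv a b.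

#[global] Instance cconv_equivalence : Equivalence cconv.
Proof.
split=> [a|a b|a b c]; [exact: rst_refl | exact: rst_sym | exact: rst_trans].
Qed.

Lemma cconv_refl a : cconv a a. Proof. exact: rst_refl. Qed.

#[global] Hint Resolve cconv_refl : core.

Lemma capp_closed (a b : combinator) : closed_term (App a b).
Proof. by apply/andP; split; exact: cterm_closed. Qed.

Definition capp a b := Combinator (capp_closed a b).

#[global] Instance capp_Proper : Proper (cconv ==> cconv ==> cconv) capp.
Proof. by move=> a a' aa' b b' bb'; exact: App_Proper. Qed.

Declare Scope comb_scope.
Delimit Scope comb_scope with comb.
Infix "@" := capp (at level 40, left associativity) : comb_scope.
Infix "=b" := cconv (at level 70) : comb_scope.
Local Open Scope comb_scope.

(* Polynomials over combinators; [PV j] is the [j]-th argument (from 0), so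
   that under [n] abstractions it is the de Bruijn index [n - j.+1]. *)
Inductive poly :=
| PV of nat
| PC of combinator
| PA of poly & poly.

Coercion PC : combinator >-> poly.
Declare Scope poly_scope.
Delimit Scope poly_scope with P.
Bind Scope poly_scope with poly.
Infix "@" := PA (at level 40, left associativity) : poly_scope.

Fixpoint arity_le n p : bool :=
  match p with
  | PV j => j < n
  | PC _ => true
  | PA p q => arity_le n p && arity_le n q
  end.

Fixpoint pinst n (s : seq combinator) p : term :=
  match p with
  | PV j => nth (Var (n - j.+1)) (map cterm s) j
  | PC a => a
  | PA p q => App (pinst n s p) (pinst n s q)
  end.

(* The term [\x_0 ... x_(n-1). p] applied to [s], partially evaluated. *)
Definition pabs n p (s : seq combinator) := iter (n - size s) Lam (pinst n s p).

Lemma pabs_closed n p s :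
  arity_le n p && (size s <= n) -> closed_term (pabs n p s).
Proof.
move=> /andP[np sn]; rewrite /closed_term closed_iter_Lam addn0.
elim: p np => [j|a|p IHp q IHq] //= => [jn|_|/andP[/IHp-> /IHq->] //].
  case: (ltnP j (size s)) => js.
    rewrite (nth_map cid) //.
    exact: closed_at_le (leq0n _) (cterm_closed _).
  by rewrite nth_default ?size_map //= ltn_sub2l // (leq_ltn_trans js).
exact: closed_at_le (leq0n _) (cterm_closed a).
Qed.

(** The default [cid] is excluded by the side conditions of [cabsE]. *)
Definition cabs n p s : combinator := insubd cid (pabs n p s).

Lemma cabsE n p s : arity_le n p -> size s <= n ->
  cabs n p s = pabs n p s :> term.
Proof. by move=> np sn; rewrite val_insubd pabs_closed // np. Qed.

Lemma cabs_app n p s a : arity_le n p -> size s < n ->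
  cabs n p s @ a =b cabs n p (rcons s a).
Proof.
move=> np sn; rewrite /cconv /= !cabsE ?size_rcons ?(ltnW sn) //.
rewrite /pabs size_rcons -[in n - size s](subnSK sn) /=.
apply: rst_trans (rst_step _ _ _ _ (beta_redex _ _)) _.
rewrite subst_iter_Lam ?cterm_closed // addn0.
have sub0 k (b : combinator) : subst k a b = b.
  exact/subst_closed/(closed_at_le _ (cterm_closed b)).
suff -> : subst (n - (size s).+1) a (pinst n s p) = pinst n (rcons s a) p.
  exact: rst_refl.
elim: p np => [j|b|p IHp q IHq] //= => [jn|/andP[/IHp-> /IHq->] //].
rewrite map_rcons nth_rcons size_map.
(* The outermost remaining abstraction binds index [n - (size s).+1]: earlier arguments are already
   filled in, later ones have smaller indices and stay, and [j = size s] receives [a]. *)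
case: (ltngtP j (size s)) => js.
- by rewrite (nth_map cid) // sub0.
- rewrite nth_default ?size_map 1?ltnW //= ifT //.
  by rewrite ltn_sub2l // (leq_ltn_trans _ jn).
- by rewrite js nth_default ?size_map //= ltnn eqxx.
Qed.

Fixpoint peval (s : seq combinator) p : combinator :=
  match p with
  | PV j => nth cid s j
  | PC a => a
  | PA p q => peval s p @ peval s q
  end.

Lemma foldl_capp_congr a b s : a =b b -> foldl capp a s =b foldl capp b s.
Proof. by elim: s a b => //= c s IHs a b ab; apply: IHs; rewrite ab. Qed.

Lemma foldl_cabs n p s t : arity_le n p -> size s + size t = n ->
  foldl capp (cabs n p s) t =b cabs n p (s ++ t).
Proof.
move=> np; elim: t s => [|a t IHt] s stn /=; first by rewrite cats0.
transitivity (foldl capp (cabs n p (rcons s a)) t).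
  by apply/foldl_capp_congr/cabs_app; rewrite // -stn /= addnS ltnS leq_addr.
by rewrite -cat_rcons; apply: IHt; rewrite size_rcons -stn addnS.
Qed.

Lemma cabs_peval n p s : arity_le n p -> size s = n ->
  foldl capp (cabs n p [::]) s =b peval s p.
Proof.
move=> np sn; rewrite foldl_cabs //= /cconv cabsE ?sn // /pabs sn subnn /=.
suff -> : pinst n s p = peval s p by exact: rst_refl.
elim: p np => //= [j jn|p IHp q IHq /andP[/IHp-> /IHq->]] //.
by rewrite (nth_map cid) // sn.
Qed.

Lemma cabs1E p a : arity_le 1 p -> cabs 1 p [::] @ a =b peval [:: a] p.
Proof. by move=> pn; exact: (@cabs_peval 1 p [:: a]). Qed.

Lemma cabs2E p a b : arity_le 2 p -> cabs 2 p [::] @ a @ b =b peval [:: a; b] p.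
Proof. by move=> pn; exact: (@cabs_peval 2 p [:: a; b]). Qed.

Lemma cabs3E p a b c : arity_le 3 p ->
  cabs 3 p [::] @ a @ b @ c =b peval [:: a; b; c] p.
Proof. by move=> pn; exact: (@cabs_peval 3 p [:: a; b; c]). Qed.

Lemma cabs4E p a b c d : arity_le 4 p ->
  cabs 4 p [::] @ a @ b @ c @ d =b peval [:: a; b; c; d] p.
Proof. by move=> pn; exact: (@cabs_peval 4 p [:: a; b; c; d]). Qed.

Definition cscott n i (s : seq combinator) : combinator :=
  cabs n (foldl PA (PV i) (map PC s)) [::].

Lemma arity_foldl n p (s : seq combinator) :
  arity_le n (foldl PA p (map PC s)) = arity_le n p.
Proof. by elim: s p => //= a s IHs p; rewrite IHs /= andbT. Qed.

Lemma peval_foldl s p ps :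
  peval s (foldl PA p ps) = foldl capp (peval s p) (map (peval s) ps).
Proof. by elim: ps p => //= q ps IHps p; rewrite IHps. Qed.

Lemma cscottE n i s : i < n -> cscott n i s = scott n i (map cterm s) :> term.
Proof.
move=> i_n; rewrite /cscott cabsE ?arity_foldl // /pabs subn0 /scott.
congr (iter n Lam).
have : pinst n [::] (PV i) = Var (n - i.+1) by rewrite /= nth_nil.
move: (PV i) (Var _).
by elim: s => //= a s IHs p t pt; apply: IHs; rewrite /= pt.
Qed.

Lemma cscott_case n i s bs : i < n -> size bs = n ->
  foldl capp (cscott n i s) bs =b foldl capp (nth cid bs i) s.
Proof.
move=> i_n bsn; rewrite cabs_peval ?arity_foldl // peval_foldl -map_comp /=.
by rewrite map_id; exact: rst_refl.
Qed.

(* Turing's fixpoint combinator applied to [f]. *)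
Definition cfix f :=
  let a := cabs 2 (PV 1 @ (PV 0 @ PV 0 @ PV 1))%P [::] in a @ a @ f.

Lemma cfixE f : cfix f =b f @ cfix f.
Proof. by rewrite {1}/cfix cabs2E //; exact: rst_refl. Qed.

(* Recursion on Scott encodings: the branch of each constructor receives the
   recursive function, then the arguments of the constructor. *)
Definition crec (cs : seq combinator) :=
  cfix (cabs 2 (foldl PA (PV 1) [seq PA (PC c) (PV 0) | c <- cs]) [::]).

Lemma crecE cs n i s : n = size cs -> i < n ->
  crec cs @ cscott n i s =b foldl capp (nth cid cs i @ crec cs) s.
Proof.
move=> nE i_n; rewrite {1}/crec cfixE -/(crec cs) cabs2E; last first.
  have : arity_le 2 (PV 1) by [].
  by elim: (cs) (PV 1) => //= c l IHl p p2; apply: IHl; rewrite /= p2.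
rewrite peval_foldl -map_comp /= cscott_case ?size_map //.
by rewrite (nth_map cid) -?nE //; exact: rst_refl.
Qed.

(* [\x_0 ... x_(k-1). scott n i [:: x_0; ...; x_(k-1)]] *)
Definition ccons n i k : combinator :=
  cabs (k + n) (foldl PA (PV (k + i)) (map PV (iota 0 k))) [::].

Lemma ccons1E n i a : i < n -> ccons n i 1 @ a =b cscott n i [:: a].
Proof. by move=> i_n; rewrite /ccons cabs_app //= ltn_add2l i_n. Qed.

Lemma ccons2E n i a b : i < n -> ccons n i 2 @ a @ b =b cscott n i [:: a; b].
Proof. by move=> i_n; rewrite /ccons !cabs_app //= ltn_add2l i_n. Qed.

(** [lam_true] is the constructor of index 0, whence the negation. *)
Definition cbool (b : bool) : combinator := cscott 2 (~~ b) [::].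

Lemma cboolE b : cbool b = (if b then lam_true else lam_false) :> term.
Proof. by rewrite /cbool cscottE //; case: b. Qed.

Lemma cbool_case b x y : cbool b @ x @ y =b if b then x else y.
Proof.
have /= -> := @cscott_case 2 (~~ b) [::] [:: x; y]; last by [].
  by case: b; exact: rst_refl.
by case: b.
Qed.

(** * The decision term *)

Local Notation ctrue := (cbool true).
Local Notation cfalse := (cbool false).

Definition cand := cabs 2 (PV 0 @ PV 1 @ cfalse)%P [::].
Definition cor := cabs 2 (PV 0 @ ctrue @ PV 1)%P [::].
Definition ciff := cabs 2 (PV 0 @ PV 1 @ (PV 1 @ cfalse @ ctrue))%P [::].

Lemma candE b c : cand @ cbool b @ cbool c =b cbool (b && c).
Proof. by rewrite /cand cabs2E //= cbool_case; case: b => /=. Qed.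

Lemma corE b c : cor @ cbool b @ cbool c =b cbool (b || c).
Proof. by rewrite /cor cabs2E //= cbool_case; case: b => /=. Qed.

Lemma ciffE b c : ciff @ cbool b @ cbool c =b cbool (b == c).
Proof.
by rewrite /ciff cabs2E //= (cbool_case c) cbool_case; case: b; case: c.
Qed.

(** * Arithmetic and finite tables on Scott numerals *)

Fixpoint cnat (n : nat) : combinator :=
  if n is n'.+1 then cscott 2 1 [:: cnat n'] else cscott 2 0 [::].

Lemma cnatE n : cnat n = enc_nat n :> term.
Proof. by elim: n => [|n IHn]; rewrite /= cscottE //= IHn. Qed.

Definition ctwo := cnat 2.

Definition csucc := ccons 2 1 1.

Definition cadd := crec
  [:: cabs 2 (PV 1) [::];
      cabs 3 (csucc @ (PV 0 @ PV 1 @ PV 2))%P [::]].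

Lemma caddE m n : cadd @ cnat m @ cnat n =b cnat (m + n).
Proof.
elim: m => [|m IHm]; rewrite /cadd [cnat _]/= crecE // -/cadd /=.
  by rewrite cabs2E.
by rewrite cabs3E //= IHm ccons1E.
Qed.

Definition cmul := crec
  [:: cabs 2 (cnat 0) [::];
      cabs 3 (cadd @ PV 2 @ (PV 0 @ PV 1 @ PV 2))%P [::]].

Lemma cmulE m n : cmul @ cnat m @ cnat n =b cnat (m * n).
Proof.
elim: m => [|m IHm]; rewrite /cmul [cnat _]/= crecE // -/cmul /=.
  by rewrite cabs2E.
by rewrite cabs3E //= IHm caddE mulSn.
Qed.

Lemma cmul2E n : cmul @ ctwo @ cnat n =b cnat (2 * n).
Proof. exact: (cmulE 2). Qed.

Definition cpow2 := crec
  [:: cabs 1 (cnat 1) [::];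
      cabs 2 (cmul @ ctwo @ (PV 0 @ PV 1))%P [::]].

Lemma cpow2E n : cpow2 @ cnat n =b cnat (2 ^ n).
Proof.
elim: n => [|n IHn]; rewrite /cpow2 [cnat _]/= crecE // -/cpow2 /=.
  by rewrite cabs1E.
by rewrite cabs2E //= IHn cmul2E expnS.
Qed.

(** Nested case distinctions on the numeral; predicates on a finite type enter the decision term in
    this form. *)
Fixpoint ctable (bs : seq bool) : combinator :=
  if bs is b :: bs' then cabs 1 (PV 0 @ cbool b @ ctable bs')%P [::]
  else cabs 1 cfalse [::].

Lemma ctableE bs n : ctable bs @ cnat n =b cbool (nth false bs n).
Proof.
elim: bs n => [|b bs IHbs] n /=; first by rewrite cabs1E //= nth_nil.
rewrite cabs1E //=; case: n => [|n] /=.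
  by have /= -> := @cscott_case 2 0 [::] [:: cbool b; ctable bs].
by have /= -> := @cscott_case 2 1 [:: cnat n] [:: cbool b; ctable bs].
Qed.

Definition cfin (T : finType) (x : T) := cnat (enum_rank x).

Definition cpred (T : finType) (p : pred T) := ctable (map p (enum T)).

Lemma cpredE (T : finType) (p : pred T) x : cpred p @ cfin x =b cbool (p x).
Proof.
rewrite /cpred /cfin ctableE (nth_map x) ?nth_enum_rank //.
by rewrite -cardE ltn_ord.
Qed.

(** * Terms for satisfaction, derivatives and their comparison *)

Section DecisionTerm.
Variables Sigma Omega : finType.
Local Notation letter := (kapt_letter Sigma Omega).
Local Notation guard := {set Omega}.
Implicit Types (e f : regex letter) (S : guard) (c : guard * Sigma).

Fixpoint ctdl (phi : tdl Omega) : combinator :=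
  match phi with
  | Join p q => cscott 3 0 [:: ctdl p; ctdl q]
  | Meet p q => cscott 3 1 [:: ctdl p; ctdl q]
  | Gen o => cscott 3 2 [:: cfin o]
  end.

Lemma ctdlE phi : ctdl phi = enc_tdl phi :> term.
Proof.
by elim: phi => [p IHp q IHq|p IHp q IHq|o]; rewrite /= cscottE //=
  ?IHp ?IHq // /enc_fin cnatE.
Qed.

Definition cletter (x : letter) : combinator :=
  match x with
  | inl a => cscott 2 0 [:: cfin a]
  | inr phi => cscott 2 1 [:: ctdl phi]
  end.

Lemma cletterE x : cletter x = enc_letter x :> term.
Proof. by case: x => [a|phi]; rewrite /= cscottE //= ?ctdlE // cnatE. Qed.

Lemma cletter_case x (a1 a2 : combinator) :
  cletter x @ a1 @ a2 =b
    match x with inl a => a1 @ cfin a | inr phi => a2 @ ctdl phi end.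
Proof.
case: x => [a|phi] /=.
  by have /= -> := @cscott_case 2 0 [:: cfin a] [:: a1; a2].
by have /= -> := @cscott_case 2 1 [:: ctdl phi] [:: a1; a2].
Qed.

Fixpoint cregex e : combinator :=
  match e with
  | Plus e f => cscott 6 0 [:: cregex e; cregex f]
  | Dot e f => cscott 6 1 [:: cregex e; cregex f]
  | Star e => cscott 6 2 [:: cregex e]
  | Zero => cscott 6 3 [::]
  | One => cscott 6 4 [::]
  | Letter x => cscott 6 5 [:: cletter x]
  end.

Lemma cregexE e : cregex e = enc_regex (@enc_letter Sigma Omega) e :> term.
Proof.
by elim: e => [e IHe f IHf|e IHe f IHf|e IHe|||x]; rewrite /= cscottE //=
  ?IHe ?IHf // cletterE.
Qed.

(** One term for each of the finitely many guards: [S] is a parameter of the construction, not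
    encoded data. *)
Definition csat S := crec
  [:: cabs 3 (cor @ (PV 0 @ PV 1) @ (PV 0 @ PV 2))%P [::];
      cabs 3 (cand @ (PV 0 @ PV 1) @ (PV 0 @ PV 2))%P [::];
      cabs 2 (cpred (mem S) @ PV 1)%P [::]].

Lemma csatE S phi : csat S @ ctdl phi =b cbool (sat S phi).
Proof.
elim: phi => [p IHp q IHq|p IHp q IHq|o];
  rewrite /csat [ctdl _]/= crecE // -/(csat S) /=.
- by rewrite cabs3E //= IHp IHq corE.
- by rewrite cabs3E //= IHp IHq candE.
- by rewrite cabs2E //= cpredE.
Qed.

Definition cnullable S := crec
  [:: cabs 3 (cor @ (PV 0 @ PV 1) @ (PV 0 @ PV 2))%P [::];
      cabs 3 (cand @ (PV 0 @ PV 1) @ (PV 0 @ PV 2))%P [::];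
      cabs 2 ctrue [::];
      cabs 1 cfalse [::];
      cabs 1 ctrue [::];
      cabs 2 (PV 1 @ cabs 1 cfalse [::] @ csat S)%P [::]].

Lemma cnullableE S e : cnullable S @ cregex e =b cbool (nullable S e).
Proof.
elim: e => [e IHe f IHf|e IHe f IHf|e IHe|||x];
  rewrite /cnullable [cregex _]/= crecE // -/(cnullable S) /=.
- by rewrite cabs3E //= IHe IHf corE.
- by rewrite cabs3E //= IHe IHf candE.
- by rewrite cabs2E.
- by rewrite cabs1E.
- by rewrite cabs1E.
- rewrite cabs2E //= cletter_case; case: x => [a|phi]; last exact: csatE.
  by rewrite cabs1E.
Qed.

Definition cderiv c := crec
  [:: cabs 3 (ccons 6 0 2 @ (PV 0 @ PV 1) @ (PV 0 @ PV 2))%P [::];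
      cabs 3 (ccons 6 0 2 @ (ccons 6 1 2 @ (PV 0 @ PV 1) @ PV 2) @
        (cnullable c.1 @ PV 1 @ (PV 0 @ PV 2) @ cregex Zero))%P [::];
      cabs 2 (ccons 6 1 2 @ (PV 0 @ PV 1) @ (ccons 6 2 1 @ PV 1))%P [::];
      cabs 1 (cregex Zero) [::];
      cabs 1 (cregex Zero) [::];
      cabs 2 (PV 1 @
        cabs 1 (cpred (pred1 c.2) @ PV 0 @ cregex One @ cregex Zero)%P [::] @
        cabs 1 (cregex Zero) [::])%P [::]].

Lemma cderivE c e : cderiv c @ cregex e =b cregex (deriv c e).
Proof.
elim: e => [e IHe f IHf|e IHe f IHf|e IHe|||x];
  rewrite /cderiv [cregex _ in X in X =b _]/= crecE // -/(cderiv c) /=.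
- by rewrite cabs3E //= IHe IHf ccons2E.
- rewrite cabs3E //= IHe IHf cnullableE cbool_case.
  by rewrite (ccons2E (cregex (deriv c e))) // ccons2E //; case: ifP.
- by rewrite cabs2E //= IHe ccons1E // ccons2E.
- by rewrite cabs1E.
- by rewrite cabs1E.
- rewrite cabs2E //= cletter_case; case: x => [a|phi]; rewrite cabs1E //=.
  by rewrite cpredE cbool_case /=; case: ifP.
Qed.

Definition cnstates := crec
  [:: cabs 3 (cmul @ (PV 0 @ PV 1) @ (PV 0 @ PV 2))%P [::];
      cabs 3 (cmul @ (PV 0 @ PV 1) @ (cpow2 @ (PV 0 @ PV 2)))%P [::];
      cabs 2 (cmul @ ctwo @ (cpow2 @ (PV 0 @ PV 1)))%P [::];
      cabs 1 (cnat 3) [::];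
      cabs 1 (cnat 3) [::];
      cabs 2 (cnat 3) [::]].

Lemma cnstatesE e : cnstates @ cregex e =b cnat (nstates e).
Proof.
elim: e => [e IHe f IHf|e IHe f IHf|e IHe|||x];
  rewrite /cnstates [cregex _]/= crecE // -/cnstates;
  rewrite [nth _ _ _]/= [foldl _ _ _]/=.
- by rewrite cabs3E //= IHe IHf cmulE.
- by rewrite cabs3E //= IHe IHf cpow2E cmulE.
- by rewrite cabs2E //= IHe cpow2E cmul2E.
- by rewrite cabs1E.
- by rewrite cabs1E.
- by rewrite cabs2E.
Qed.

Definition csame (Ss : seq guard) : combinator :=
  foldr (fun S (acc : combinator) => cabs 2 (cand @
      (ciff @ (cnullable S @ PV 0) @ (cnullable S @ PV 1)) @
      (acc @ PV 0 @ PV 1))%P [::])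
    (cabs 2 ctrue [::]) Ss.

Lemma csameE Ss e f : csame Ss @ cregex e @ cregex f =b
  cbool (all (fun S => nullable S e == nullable S f) Ss).
Proof.
elim: Ss => [|S Ss IHSs] /=; rewrite cabs2E //=.
by rewrite !cnullableE ciffE IHSs candE.
Qed.

(** An unrolled conjunction over [cs]; argument 0 is the comparison at the smaller depth. *)
Definition cnext (cs : seq (guard * Sigma)) : combinator :=
  foldr (fun c (acc : combinator) => cabs 3 (cand @
      (PV 0 @ (cderiv c @ PV 1) @ (cderiv c @ PV 2)) @
      (acc @ PV 0 @ PV 1 @ PV 2))%P [::])
    (cabs 3 ctrue [::]) cs.

Lemma cnextE cs k (p : rel (regex letter)) e f :
  (forall e f, k @ cregex e @ cregex f =b cbool (p e f)) ->
  cnext cs @ k @ cregex e @ cregex f =b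
    cbool (all (fun c => p (deriv c e) (deriv c f)) cs).
Proof.
move=> kp; elim: cs => [|c cs IHcs] /=; rewrite cabs3E //=.
by rewrite !cderivE kp IHcs candE.
Qed.

Definition cagree := crec
  [:: cabs 3 ctrue [::];
      cabs 4 (cand @ (csame (enum {: guard}) @ PV 2 @ PV 3) @
        (cnext (enum {: guard * Sigma}) @ (PV 0 @ PV 1) @ PV 2 @ PV 3))%P [::]].

Lemma cagreeE n e f :
  cagree @ cnat n @ cregex e @ cregex f =b cbool (agree n e f).
Proof.
elim: n e f => [|n IHn] e f; rewrite /cagree [cnat _]/= crecE // -/cagree /=.
  by rewrite cabs3E.
by rewrite cabs4E //= csameE (cnextE _ _ _ IHn) candE.
Qed.

Definition cdecide :=
  cabs 2 (cagree @ (cmul @ (cnstates @ PV 0) @ (cnstates @ PV 1)) @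
    PV 0 @ PV 1)%P [::].

Lemma cdecideE e f :
  cdecide @ cregex e @ cregex f =b
    cbool (agree (nstates e * nstates f) e f).
Proof. by rewrite /cdecide cabs2E //= !cnstatesE cmulE cagreeE. Qed.

Lemma kapt_decidable :
  decidable_rel (enc_regex (@enc_letter Sigma Omega))
    (ka (@H_kapt Sigma Omega)).
Proof.
exists cdecide; first exact: cterm_closed.
move=> e f; rewrite -!cregexE; have := cdecideE e f; rewrite /cconv cboolE.
(* Completeness for guarded strings and the depth bound turn derivability into the Boolean that the
   term computes. *)
have -> : ka (@H_kapt Sigma Omega) e f <-> agree (nstates e * nstates f) e f.
  by rewrite kaP agreeP.
by case: agree => /= dE; split.
Qed.

End DecisionTerm.

Theorem theorem9p6 (Sigma Omega : finType) :
  [/\ reduces_to_empty (@H_kapt Sigma Omega),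
      ka_complete (@H_kapt Sigma Omega) &
      decidable_rel (enc_regex (@enc_letter Sigma Omega))
        (ka (@H_kapt Sigma Omega))].
Proof.
split; [exact: kapt_reduces | exact: kapt_complete | exact: kapt_decidable].
Qed.
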